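(* There exist constants $n_0$ and $c$ such that the following holds. Let $D=(V,E)$ be a digraph on $n\geq n_0$ vertices. Set $t:=c(n\log n)^{2/5}$ and let $A^+:=\{v\in V:\mathrm{ex}_D(v)\geq t\}$, $A^-:=\{v\in V:\mathrm{ex}_D(v)\leq -t\}$ and $A^0:=V\setminus(A^+\cup A^-)$. Assume there is some $d\geq t$ such that (i) for every $v\in A^+$ we have $d/4\leq e_D(v,A^-)\leq d$; (ii) for every $v\in A^-$ we have $d/4\leq e_D(A^+,v)\leq d$; (iii) for every $v\in A^+\cup A^-$ we have $e_D(v,A^0)\leq\min\{d/3,t^2/10^6\}$ and $e_D(A^0,v)\leq\min\{d/3,t^2/10^6\}$; and (iv) for every $v\in A^0$ we have $e_D(A^+,v)\geq d/3$ and $e_D(v,A^-)\geq d/3$. Then $D$ is consistent.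
   Context: A digraph $D=(V(D),E(D))$ is loopless and, for each pair of distinct vertices, has at most one edge in each direction. For a vertex $v$ and a set $S\subseteq V(D)$, $e_D(v,S)$ is the number of outneighbours of $v$ in $S$ and $e_D(S,v)$ is the number of inneighbours of $v$ in $S$. With $d_D^+(v)$, $d_D^-(v)$ the out- and indegree, the excess at $v$ is $\mathrm{ex}_D(v)=d_D^+(v)-d_D^-(v)$, and the excess of $D$ is $\mathrm{ex}(D)=\frac12\sum_{v\in V(D)}|\mathrm{ex}_D(v)|$. A path decomposition of $D$ is a collection of (directed) paths of $D$ (with no repeated vertices) whose edge sets partition $E(D)$; $\mathrm{pn}(D)$ is the minimum number of paths in a path decomposition of $D$; one always has $\mathrm{pn}(D)\geq\mathrm{ex}(D)$. $D$ is consistent if $\mathrm{pn}(D)=\mathrm{ex}(D)$. Logarithms are natural. *)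

(* Defs.v *)
From mathcomp Require Import all_boot all_order all_algebra.
From mathcomp Require Import boolp reals exp.

Set Implicit Arguments.
Unset Strict Implicit.
Unset Printing Implicit Defensive.

Import Order.TTheory GRing.Theory Num.Theory.
Local Open Scope ring_scope.

Record digraph (V : finType) := Digraph {
  arc_rel :> rel V;
  arc_irrefl : irreflexive arc_rel
}.

Definition arcs (V : finType) (D : digraph V) : {set V * V} :=
  [set e | D e.1 e.2].

(* [e_out D v S] is e_D(v, S) and [e_in D S v] is e_D(S, v). *)
Definition e_out (V : finType) (D : digraph V) (v : V) (S : {set V}) : nat :=
  #|[set u in S | D v u]|.

Definition e_in (V : finType) (D : digraph V) (S : {set V}) (v : V) : nat :=
  #|[set u in S | D u v]|.

Definition outdeg (V : finType) (D : digraph V) (v : V) : nat :=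
  e_out D v [set: V].

Definition indeg (V : finType) (D : digraph V) (v : V) : nat :=
  e_in D [set: V] v.

Definition excess_at (V : finType) (D : digraph V) (v : V) : int :=
  (outdeg D v)%:Z - (indeg D v)%:Z.

Definition excess (V : finType) (D : digraph V) : rat :=
  (\sum_(v : V) `|excess_at D v|)%:~R / 2.

(* A path is given by its nonempty sequence of vertices. *)
Definition dipath (V : finType) (D : digraph V) (p : seq V) : bool :=
  if p is x :: q then path D x q && uniq p else false.

Definition path_arcs (V : finType) (p : seq V) : seq (V * V) :=
  zip p (behead p).

(* As [enum (arcs D)] is duplicate-free, the [perm_eq] says that every arc of D
   lies on exactly one path of P. One-vertex paths are harmless members of P:
   they do not change the minimum [pn]. *)
Definition path_decomposition (V : finType) (D : digraph V)
    (P : seq (seq V)) : bool :=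
  all (dipath D) P && perm_eq (flatten (map (@path_arcs V) P)) (enum (arcs D)).

Lemma path_decomposition_exists (V : finType) (D : digraph V) :
  exists k : nat,
    `[< exists2 P, path_decomposition D P & size P = k >].
Proof.
pose P := [seq [:: e.1; e.2] | e <- enum (arcs D)].
exists (size P); apply/asboolP; exists P => //; apply/andP; split.
- apply/allP => p /mapP[[x y]]; rewrite mem_enum inE /= => Dxy ->.
  rewrite /= Dxy inE !andbT /=; apply/eqP => xy.
  by move: Dxy; rewrite xy arc_irrefl.
- rewrite /P -map_comp; have -> // : forall s : seq (V * V),
    flatten [seq (@path_arcs V \o (fun e => [:: e.1; e.2])) i | i <- s] = s.
  by elim=> [//|[x y] s /= ->].
Qed.

Definition pn (V : finType) (D : digraph V) : nat :=
  ex_minn (path_decomposition_exists D).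

Definition consistent (V : finType) (D : digraph V) : Prop :=
  (pn D)%:R = excess D.

Definition Aplus (R : realType) (V : finType) (D : digraph V) (t : R) :
    {set V} :=
  [set v | t <= (excess_at D v)%:~R].

Definition Aminus (R : realType) (V : finType) (D : digraph V) (t : R) :
    {set V} :=
  [set v | (excess_at D v)%:~R <= - t].

Definition Azero (R : realType) (V : finType) (D : digraph V) (t : R) :
    {set V} :=
  ~: (Aplus D t :|: Aminus D t).

(* Main.v *)
(** Reserve about [t / 10] arcs from A+ to A- at each vertex of these two sets, and
    as many arcs from A+ and to A- at each vertex of A0. The remaining digraph splits
    into paths from positive to negative excess and a balanced digraph E.

    A balanced digraph on at most [a ^ 3] vertices S with m arcs has a cycle of
    length at least [m / (2 a #|S|)], so it has a decomposition into few cycles. Cut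
    each cycle at two vertices, never using a vertex too often; of the cycles that
    run out of vertices, cut once, exchange tails where two of them meet, and recurse
    on the remaining arcs, which span at most half of the vertices. This decomposes E
    into paths Q of which only about [n ^ (1/3) (log n) ^ 2] start, and equally many
    end, at each vertex, much less than [t].

    A path Q starting outside A+ is prolonged by a reserved arc from A+ to its start,
    and similarly at its end; the result starts in A+ and ends in A-, and does not
    close up provided that enough reserved neighbours of the two ends avoid Q. If
    they do not, Q is cut further, at some w and a later z in A+ such that enough
    reserved neighbours of w and of z avoid the stretch from w to z. Such a pair is
    found by a walk of constantly many steps: go from the start of Q to one of its
    reserved neighbours z on Q, from z to one of its reserved neighbours w on Q, and
    so on inward. Steps that do not succeed lead to sets of vertices growing by a
    factor of at least [n ^ (1/60)], so a bounded number of steps suffices, and as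
    each step has many choices the cuts can be spread evenly over the vertices.

    All paths obtained start at vertices of positive excess and end at vertices of
    negative excess, so their number is the excess of D. *)
Require Import Defs.
From mathcomp Require Import all_boot all_order all_algebra.
From mathcomp Require Import boolp reals exp.
From mathcomp Require Import zify ring lra.

Set Implicit Arguments.
Unset Strict Implicit.
Unset Printing Implicit Defensive.

Import Order.TTheory GRing.Theory Num.Theory.
Local Open Scope nat_scope.

(** * Lists of arcs and of paths *)

Section Arcs.
Variable V : finType.
Implicit Types (A B : seq (V * V)) (p q : seq V) (P : seq (seq V)) (v : V).

(** Arcs and paths are kept in lists rather than sets: degrees and numbers of starts then add under
    concatenation, and a partition of the arcs is a [perm_eq]. *)
Definition outc A v := count (fun e => e.1 == v) A.
Definition inc A v := count (fun e => e.2 == v) A.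
Definition starts P v := count (fun p => ohead p == Some v) P.
Definition ends P v := count (fun p => ohead (rev p) == Some v) P.
Definition arcs_of P := flatten (map (@path_arcs V) P).
Definition balanced A := forall v, outc A v = inc A v.
Definition loopless A := all (fun e => e.1 != e.2) A.

Lemma outc_cat A B v : outc (A ++ B) v = outc A v + outc B v.
Proof. exact: count_cat. Qed.

Lemma inc_cat A B v : inc (A ++ B) v = inc A v + inc B v.
Proof. exact: count_cat. Qed.

Lemma outc_perm A B v : perm_eq A B -> outc A v = outc B v.
Proof. by move/permP; apply. Qed.

Lemma inc_perm A B v : perm_eq A B -> inc A v = inc B v.
Proof. by move/permP; apply. Qed.

Lemma starts_cat P Q v : starts (P ++ Q) v = starts P v + starts Q v.
Proof. exact: count_cat. Qed.

Lemma arcs_of_cat P Q : arcs_of (P ++ Q) = arcs_of P ++ arcs_of Q.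
Proof. by rewrite /arcs_of map_cat flatten_cat. Qed.

Lemma perm_arcs_of P Q : perm_eq P Q -> perm_eq (arcs_of P) (arcs_of Q).
Proof. by move=> PQ; apply: perm_flatten; apply: perm_map. Qed.

Lemma ohead_rev x p : ohead (rev (x :: p)) = Some (last x p).
Proof. by rewrite lastI rev_rcons. Qed.

Lemma path_arcs_cons x y p : path_arcs (x :: y :: p) = (x, y) :: path_arcs (y :: p).
Proof. by []. Qed.

Lemma path_arcs_cat p x q :
  path_arcs (p ++ x :: q) = path_arcs (rcons p x) ++ path_arcs (x :: q).
Proof.
elim: p => [|y [|z p] IH] //=.
by rewrite !path_arcs_cons IH.
Qed.

(** Each visit of [v] is followed by an arc unless it is the last entry and preceded by one unless
    it is the first. Vertices may repeat, so closed sequences are covered. *)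
Lemma path_arcs_degree p v :
  outc (path_arcs p) v + (ohead (rev p) == Some v) =
  inc (path_arcs p) v + (ohead p == Some v).
Proof.
case: p => [|x p] //; rewrite ohead_rev.
elim: p x => [|y p IH] x //.
rewrite path_arcs_cons /outc /inc /= -/(outc _ v) -/(inc _ v).
move: (IH y) => /=; rewrite !(inj_eq Some_inj); lia.
Qed.

(** The difference of starts and ends at a vertex depends on the arcs alone; for balanced arcs it is
    zero. *)
Lemma arcs_of_degree P v :
  outc (arcs_of P) v + ends P v = inc (arcs_of P) v + starts P v.
Proof.
elim: P => [|p P IH] //=.
rewrite /arcs_of /= -/(arcs_of P) outc_cat inc_cat.
have := path_arcs_degree p v; lia.
Qed.

Lemma path_arcsE (e : rel V) x p :
  path e x p = all (fun a => e a.1 a.2) (path_arcs (x :: p)).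
Proof. by elim: p x => [|y p IH] x //=; rewrite IH. Qed.

Lemma mem_path_arcs p a : a \in path_arcs p -> (a.1 \in p) && (a.2 \in p).
Proof.
case: p => [|x p] //; elim: p x => [|y p IH] x //.
rewrite path_arcs_cons inE => /orP[/eqP-> /=|/IH /andP[h1 h2]].
  by rewrite !inE !eqxx orbT.
by rewrite inE h1 inE h2 !orbT.
Qed.

Lemma map_fst_path_arcs x p : map fst (path_arcs (x :: p)) = belast x p.
Proof. by elim: p x => [|y p IH] x //=; rewrite -IH. Qed.

Lemma map_snd_path_arcs x p : map snd (path_arcs (x :: p)) = p.
Proof. by elim: p x => [|y p IH] x //=; rewrite -[in RHS](IH y). Qed.

Lemma uniq_path_arcs x p : uniq p -> uniq (path_arcs (x :: p)).
Proof. by rewrite -{1}(map_snd_path_arcs x p) => /map_uniq. Qed.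

Lemma uniq_arcs_of_uniq p : uniq p -> uniq (path_arcs p).
Proof. by case: p => [|x p] // /andP[_]; exact: uniq_path_arcs. Qed.

Lemma shorten_arcs x p : x != last x p ->
  exists q, [/\ uniq (x :: q), q != [::], last x q = last x p &
    {subset path_arcs (x :: q) <= path_arcs (x :: p)}].
Proof.
(* With the arcs of the walk itself as relation, [shortenP] yields a path that uses no other
   arcs. *)
move=> xl; pose e : rel V := fun u v => (u, v) \in path_arcs (x :: p).
have: path e x p by rewrite path_arcsE; apply/allP => -[u v].
move=> pe; move: xl; case/shortenP: pe => q eq uq _ xl; exists q; split => //.
- by apply: contraNneq xl => ->.
- by move: eq; rewrite path_arcsE => /allP h [u v] /h.
Qed.

Lemma perm_diff (T : eqType) (s t : seq T) : uniq s -> uniq t -> {subset t <= s} ->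
  perm_eq (t ++ [seq x <- s | x \notin t]) s.
Proof.
move=> us ut ts; apply: uniq_perm => //.
- rewrite cat_uniq ut filter_uniq // andbT.
  by apply/hasPn => x; rewrite mem_filter => /andP[].
- move=> x; rewrite mem_cat mem_filter.
  by case: (boolP (x \in t)) => //= /ts ->.
Qed.

(** Grouped by vertices, the sides weight [g v] by out- and indegree. Thus any potential rises over
    the arcs as much as it falls. *)
Lemma balanced_sum A (g : V -> nat) : balanced A ->
  \sum_(e <- A) g e.1 = \sum_(e <- A) g e.2.
Proof.
move=> bA.
have h (f : V * V -> V) : \sum_(e <- A) g (f e) = \sum_v g v * count (fun e => f e == v) A.
  elim: A {bA} => [|e A IH]; first by rewrite big_nil big1 // => v _; rewrite muln0.
  rewrite big_cons IH (bigD1 (f e)) //= [in RHS](bigD1 (f e)) //= eqxx.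
  rewrite addnA mulnDr muln1; congr (_ + _).
  by apply: eq_bigr => v /negbTE; rewrite eq_sym => ->.
by rewrite (h fst) (h snd); apply: eq_bigr => v _; rewrite -/(outc A v) bA.
Qed.

Lemma balanced_perm A B : perm_eq A B -> balanced A -> balanced B.
Proof. by move=> AB bA v; rewrite -(outc_perm v AB) -(inc_perm v AB). Qed.

Lemma balanced_catr A B : balanced (A ++ B) -> balanced A -> balanced B.
Proof. by move=> bAB bA v; have := bAB v; rewrite outc_cat inc_cat bA => /addnI. Qed.

Lemma balanced_cat A B : balanced A -> balanced B -> balanced (A ++ B).
Proof. by move=> bA bB v; rewrite outc_cat inc_cat bA bB. Qed.

End Arcs.


(** * Assignments with bounded loads *)

Section Assignment.
Variables (I X : finType) (P : pred I) (cand : I -> {set X}).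

Definition load (f : I -> X) x := \sum_(i | P i) (f i == x).

Definition movable (f : I -> X) x y := [exists i, [&& P i, f i == x & y \in cand i]].

(** Moving one item along each step of the path passes one unit of load from its first vertex to its
    last and leaves the loads in between unchanged. *)
Lemma shift_load (f : I -> X) x p : (forall i, P i -> f i \in cand i) ->
  path (movable f) x p -> uniq (x :: p) ->
  exists f' : I -> X, (forall i, P i -> f' i \in cand i) /\
    forall z, load f' z + (x == z) = load f z + (last x p == z).
Proof.
elim: p f x => [|y p IH] f x vf; first by exists f.
move=> /= /andP[/existsP[i /and3P[Pi /eqP fi yi]] pp] /andP[xp uyp].
pose f1 j := if j == i then y else f j.
have f1load z : load f1 z + (x == z) = load f z + (y == z).
  rewrite /load (bigD1 i) //= [in RHS](bigD1 i) //= {1}/f1 eqxx fi.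
  rewrite (eq_bigr (fun j => nat_of_bool (f j == z))) => [|j /andP[_ /negbTE ji]]; first by lia.
  by rewrite /f1 ji.
have [||//|f' [vf' lf']] := IH f1 y.
- by move=> j Pj; rewrite /f1; case: eqP => [->|_] //; apply: vf.
(* Reassigning [i] can only destroy moves out of [x], which the rest of the path avoids. *)
- apply: (@sub_in_path _ (predC1 x) (movable f)) pp.
    move=> u w /= ux _ /existsP[j /and3P[Pj /eqP fj wj]].
    apply/existsP; exists j; rewrite Pj wj andbT /f1.
    case: (eqVneq j i) => [ji|_]; last exact/eqP.
    by move: ux; rewrite inE -fj ji fi eqxx.
  by apply/allP => u up /=; apply: contraNneq xp => <-.
- by exists f'; split => // z; move: (lf' z) (f1load z) => /=; lia.
Qed.

(* An overloaded vertex reaches an underloaded one through single-item moves: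
   otherwise the vertices it reaches would be candidates more than [D * m]
   times on average. *)
Lemma bounded_assignment (x0 : X) (D m : nat) :
  0 < D ->
  (forall i, P i -> D <= #|cand i|) ->
  (forall x, \sum_(i | P i) (x \in cand i) <= D * m) ->
  exists f : I -> X, (forall i, P i -> f i \in cand i) /\ (forall x, load f x <= m).
Proof.
move=> D0 candD candm.
pose valid (f : {ffun I -> X}) := [forall i, P i ==> (f i \in cand i)].
(* The total overload; the witness is a valid assignment that minimises it. *)
pose ov (f : {ffun I -> X}) := \sum_x (load f x - m).
pose f0 : {ffun I -> X} := [ffun i => odflt x0 [pick x in cand i]].
have vf0 : valid f0.
  apply/forallP => i; apply/implyP => Pi; rewrite ffunE.
  case: pickP => [x|] //= no; have := candD i Pi.
  by rewrite leqNgt (eq_card0 no) D0.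
case: (arg_minnP ov vf0) => f vf minf.
have vf' i : P i -> f i \in cand i by move=> Pi; have /forallP/(_ i)/implyP := vf; apply.
exists f; split => // x; rewrite leqNgt; apply/negP => mx.
pose T := [set y | connect (movable f) x y].
have xT : x \in T by rewrite inE connect0.
have Tm y : y \in T -> m <= load f y.
  rewrite inE => /connectP[p pp yp]; rewrite leqNgt; apply/negP => ym.
  move: yp; case/shortenP: pp => q pq uq _ yq.
  have [f' [vf1 lf1]] := shift_load vf' pq uq.
  have lff z : load [ffun i => f' i] z = load f' z.
    by apply: eq_bigr => i _; rewrite ffunE.
  have: ov f <= ov [ffun i => f' i].
    by apply: minf; apply/forallP => i; rewrite ffunE; apply/implyP/vf1.
  rewrite leqNgt => /negP; apply.
  have -> : (ov [ffun i => f' i]).+1 = \sum_z ((load f' z - m) + (x == z)).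
    rewrite big_split /= (bigD1 x (F := fun z => nat_of_bool (x == z))) //= eqxx.
    rewrite [X in (_ + (_ + X))]big1 => [|z /negbTE]; last by rewrite eq_sym => ->.
    by rewrite addn0 addn1; congr _.+1; apply: eq_bigr => z _; rewrite lff.
  apply: leq_sum => z _; have := lf1 z; rewrite -yq.
  case: (eqVneq x z) => [<-|_]; last first.
    by case: (eqVneq y z) => [<-|_]; lia.
  by case: (eqVneq y x) => [yx|_]; first (move: mx ym; rewrite yx); lia.
have sumT : m * #|T| < \sum_(y in T) load f y.
  rewrite (bigD1 x) //= (cardD1 x) xT mulnDr muln1 -addSn leq_add //.
  rewrite mulnC -sum_nat_const (eq_bigl (fun y => (y \in T) && (y != x))).
    by apply: leq_sum => y /andP[/Tm].
  by move=> y; rewrite !inE andbC.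
have: D * \sum_(y in T) load f y <= D * (m * #|T|).
  have -> : \sum_(y in T) load f y = \sum_(i | P i) (f i \in T).
    rewrite exchange_big /=; apply: eq_bigr => i Pi.
    case: (boolP (f i \in T)) => fT.
      rewrite (bigD1 (f i)) //= eqxx big1 // => y /andP[_ /negbTE].
      by rewrite eq_sym => ->.
    by rewrite big1 // => y yT; case: eqP => // fy; rewrite fy yT in fT.
  (* An item placed in [T] has all its candidates in [T], since moving it is one step. So it
     accounts for at least [D] incidences, of which each vertex of [T] has at most [D * m]. *)
  apply: (@leq_trans (\sum_(i | P i) \sum_(y in T) (y \in cand i))).
    rewrite big_distrr /=; apply: leq_sum => i Pi.
    case: (boolP (f i \in T)) => fT; last by rewrite muln0.
    rewrite muln1 (leq_trans (candD i Pi)) // -sum1_card big_mkcond /=.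
    rewrite [X in _ <= X]big_mkcond /=; apply: leq_sum => y _.
    case: (boolP (y \in cand i)) => yi //.
    suff -> : y \in T by [].
    rewrite inE (connect_trans (y := f i)) //; first by move: fT; rewrite inE.
    by apply/connect1/existsP; exists i; rewrite Pi eqxx.
  rewrite exchange_big /= mulnA mulnC -sum_nat_const.
  by apply: leq_sum => y _; apply: candm.
by rewrite leq_pmul2l // leqNgt sumT.
Qed.

End Assignment.

(** * Long cycles and cycle decompositions of balanced digraphs *)

(** Among [k.+1] distinct positive numbers one exceeds [k]; remove it and induct. *)
Lemma sumn_uniq_pos (s : seq nat) : uniq s -> all (ltn 0) s -> size s ^ 2 <= 2 * sumn s.
Proof.
move: {2}(size s) (erefl (size s)) => k; elim: k s => [|k IH] s sk us ps.
  by rewrite sk.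
have [M Ms kM] : exists2 x, x \in s & k < x.
  apply/hasP; apply/negPn/negP => /hasPn h.
  suff: size s <= size (iota 1 k) by rewrite size_iota sk ltnn.
  apply: uniq_leq_size => // x xs; rewrite mem_iota.
  by have := h x xs; have /allP/(_ x xs) /= := ps; lia.
have kr : size (rem M s) = k by rewrite size_rem // sk.
have := IH (rem M s) kr (rem_uniq M us).
rewrite kr sk (perm_sumn (perm_to_rem Ms)) /= => /(_ _)/wrap[].
  by apply/allP => x /mem_rem xs; have /allP := ps; apply.
by nia.
Qed.

(** Cauchy's inequality, from the bound on a product of two numbers by their squares, summed over
    all pairs. *)
Lemma sum_sqr_le (I : finType) (S : {set I}) (f : I -> nat) :
  (\sum_(i in S) f i) ^ 2 <= #|S| * \sum_(i in S) f i ^ 2.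
Proof.
rewrite -(@leq_pmul2l 2) //.
have -> : 2 * (#|S| * \sum_(i in S) f i ^ 2) = \sum_(i in S) \sum_(j in S) (f i ^ 2 + f j ^ 2).
  transitivity (\sum_(i in S) (#|S| * f i ^ 2 + \sum_(j in S) f j ^ 2)).
    by rewrite big_split /= -big_distrr /= sum_nat_const mulnA mul2n -addnn mulnDl.
  by apply: eq_bigr => i _; rewrite big_split /= sum_nat_const.
rewrite expnS expn1 big_distrlr /= big_distrr /=; apply: leq_sum => i _.
by rewrite big_distrr /=; apply: leq_sum => j _; exact: nat_Cauchy.
Qed.

Section Cycles.
Variable V : finType.
Implicit Types (A B : seq (V * V)) (p q c : seq V) (P : seq (seq V)) (v : V).

(** The vertices of a cycle are listed once; the closing arc comes from appending the first
    vertex. *)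
Definition cycle_arcs c := if c is x :: p then path_arcs (x :: rcons p x) else [::].

(** For [v] on the cycle, the vertices that follow it in cyclic order: [v :: unroot c v] is a
    rotation of [c]. *)
Definition unroot c v := drop (index v c).+1 c ++ take (index v c) c.

Lemma reroot c v : uniq c -> v \in c ->
  [/\ uniq (v :: unroot c v), perm_eq (v :: unroot c v) c &
      perm_eq (path_arcs (v :: rcons (unroot c v) v)) (cycle_arcs c)].
Proof.
move=> uc vc; have Ec : rot (index v c) c = v :: unroot c v := rot_index vc.
have pe : perm_eq (v :: unroot c v) c by rewrite -Ec perm_rot perm_refl.
split; [by rewrite (perm_uniq pe)|done|].
have := cat_take_drop (index v c) c; rewrite (drop_nth v) ?index_mem // nth_index //.
rewrite /unroot; case: (take _ c) (drop _.+1 c) => [|x p1] p2 /= <-.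
  by rewrite cats0 perm_refl.
rewrite rcons_cat /= -cat_cons path_arcs_cat rcons_cat rcons_cons -cat_cons.
by rewrite path_arcs_cat perm_catC perm_refl.
Qed.

Lemma mem_cycle_arcs c a : a \in cycle_arcs c -> (a.1 \in c) && (a.2 \in c).
Proof.
case: c => // x p /mem_path_arcs; rewrite -rcons_cons !mem_rcons !inE !orbA !orbb.
by [].
Qed.

Lemma cycle_arcs_mem c v : v \in c -> exists2 w, (v, w) \in cycle_arcs c & w \in c.
Proof.
case: c => // x p vc; suff [w vw] : exists w, (v, w) \in cycle_arcs (x :: p).
  by exists w => //; have /andP[] := mem_cycle_arcs vw.
have : v \in map fst (cycle_arcs (x :: p)).
  by rewrite map_fst_path_arcs belast_rcons.
by case/mapP => -[u w] uw /= ->; exists w.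
Qed.

Lemma uniq_cycle_arcs c : uniq c -> uniq (cycle_arcs c).
Proof.
by case: c => // x p uc; apply: uniq_path_arcs; rewrite rcons_uniq.
Qed.

Lemma balanced_cycle c : balanced (cycle_arcs c).
Proof.
case: c => // x p v; have := path_arcs_degree (x :: rcons p x) v.
by rewrite ohead_rev last_rcons /= => /addIn.
Qed.

Definition arcs_in A (S : {set V}) := all (fun e => (e.1 \in S) && (e.2 \in S)) A.

(* [phi v] is the length of a longest path ending at [v]. If no cycle is longer
   than [l], an arc that does not increase [phi] leads back to one of the last
   [l] vertices of such a path, so there are at most [#|S| * l] of these arcs and
   they decrease [phi] by less than [l]. As [phi] sums to zero over the arcs of a
   balanced digraph, this bounds the increasing arcs by [#|S| * l ^ 2]; the same
   argument for the rank of [v] with respect to [phi], under which the increasing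
   arcs at a vertex have distinct lengths, bounds their square by
   [2 * #|S| ^ 3 * l]. *)
Section LongCycle.
Variables (A : seq (V * V)) (S : {set V}).
Hypotheses (uA : uniq A) (lA : loopless A) (bA : balanced A) (AS : arcs_in A S).
Let e : rel V := fun u v => (u, v) \in A.

Let path_to v k := `[< exists x p, [/\ path e x p, uniq (x :: p), last x p = v & size p = k] >].

Let path_to_ex v : exists k, path_to v k.
Proof. by exists 0; apply/asboolP; exists v, [::]. Qed.

Let path_to_bound v k : path_to v k -> k <= #|V|.
Proof.
move/asboolP => [x [p [_ /card_uniqP up _ <-]]].
by have := max_card (mem (x :: p)); rewrite up /=; lia.
Qed.

Let phi v := ex_maxn (path_to_ex v) (path_to_bound (v := v)).

Let phi_max v k : path_to v k -> k <= phi v.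
Proof. by rewrite /phi; case: ex_maxnP => m _ h /h. Qed.

Let phi_path v : exists x p, [/\ path e x p, uniq (x :: p), last x p = v & size p = phi v].
Proof. by rewrite /phi; case: ex_maxnP => m /asboolP. Qed.

Variable l : nat.
Hypothesis cycle_bound : forall c, uniq c -> {subset cycle_arcs c <= A} -> size c <= l.

Let back_arc u v x p : path e x p -> uniq (x :: p) -> last x p = u -> size p = phi u ->
  (u, v) \in A -> phi v <= phi u ->
  phi u <= phi v + l.-1 /\ v \in drop (size (x :: p) - l) (x :: p).
Proof.
move=> pp up lp sp uv vu; have vp : v \in x :: p.
  apply: contraLR vu => vp; rewrite -ltnNge; apply: phi_max.
  apply/asboolP; exists x, (rcons p v); split.
  - by rewrite rcons_path pp lp.
  - by rewrite -rcons_cons rcons_uniq vp.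
  - by rewrite last_rcons.
  - by rewrite size_rcons sp.
have [p1 [p2 xp]] : exists p1 p2, x :: p = p1 ++ v :: p2.
  by case/splitPr: vp => p1 p2; exists p1, p2.
(* The arc closes the end of the path from [v] on to a cycle, so this end is short; the part up to
   [v] is a path that bounds [phi v] from below. *)
have vp2 : size (v :: p2) <= l.
  apply: cycle_bound; first by move: up; rewrite xp cat_uniq => /and3P[].
  have lv : last v p2 = u.
    by rewrite -lp -[last x p]/(last x (x :: p)) xp last_cat.
  have : path e v (rcons p2 v).
    rewrite rcons_path lv; apply/andP; split=> //.
    case: p1 xp => [[<- <-] //|y p1 [_ xp]].
    by move: pp; rewrite xp cat_path => /= /and3P[].
  by rewrite path_arcsE => /allP h [a b] /h.
have size_xp : size (x :: p) = size p1 + size (v :: p2) by rewrite xp size_cat.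
split => //; last first.
  rewrite xp drop_cat size_cat; case: ifP => [_|]; first by rewrite mem_cat mem_head orbT.
  by move/negbT; rewrite -leqNgt => h; have -> : size p1 + size (v :: p2) - l - size p1 = 0;
     [lia | rewrite drop0 mem_head].
suff: size p1 <= phi v by move: size_xp vp2 => /=; lia.
apply: phi_max; apply/asboolP.
case: p1 xp {size_xp} => [|y p1 [<- xp]]; first by exists v, [::].
exists x, (rcons p1 v); rewrite last_rcons size_rcons; split => //.
  by move: pp; rewrite xp -cat_rcons cat_path => /andP[].
by move: up; rewrite xp -cat_rcons -cat_cons cat_uniq => /andP[].
Qed.

Let F : pred (V * V) := fun a => phi a.1 < phi a.2.

Let sum_by_source (g : V * V -> nat) (Q : pred (V * V)) :
  \sum_(a <- A | Q a) g a = \sum_(u in S) \sum_(a <- A | Q a && (a.1 == u)) g a.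
Proof.
rewrite (exchange_big_dep Q) /=; last by move=> u a _ /andP[].
rewrite big_seq_cond [RHS]big_seq_cond; apply: eq_bigr => a /andP[aA Qa].
have /allP/(_ a aA)/andP[a1 _] := AS.
rewrite (big_pred1 a.1) // => u; rewrite /= Qa /= eq_sym.
by case: (eqVneq u a.1) => [->|_]; rewrite ?a1 ?andbF.
Qed.

Let back_count : count (predC F) A <= #|S| * l.
Proof.
rewrite -sum1_count sum_by_source -sum_nat_const; apply: leq_sum => u _.
rewrite sum1_count -size_filter; set Bu := filter _ _.
case: (posnP (size Bu)) => [->//|]; rewrite -has_predT => /hasP[[u' v0]].
rewrite mem_filter /= => /andP[/andP[nF /eqP->] _] _.
have [x [p [pp up lp sp]]] := phi_path u.
have -> : size Bu = size (map snd Bu) by rewrite size_map.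
apply: (@leq_trans (size (drop (size (x :: p) - l) (x :: p)))); last by rewrite size_drop; lia.
apply: uniq_leq_size.
  rewrite map_inj_in_uniq ?filter_uniq // => -[a1 a2] [b1 b2].
    by rewrite !mem_filter /= => /andP[/andP[_ /eqP->] _] /andP[/andP[_ /eqP->] _] ->.
move=> v /mapP[[a1 a2]]; rewrite mem_filter /= -leqNgt => /andP[/andP[vu /eqP a1u] aA] ->.
by rewrite {}a1u in vu aA; have [] := back_arc pp up lp sp aA vu.
Qed.

Let back_step a : a \in A -> phi a.1 + F a <= phi a.2 + ~~ F a * l.-1.
Proof.
case: a => u v aA; rewrite /F /=; case: ltnP => /= uv; first by rewrite addn1 addn0.
have [x [p [pp up lp sp]]] := phi_path u.
by rewrite addn0 mul1n; have [] := back_arc pp up lp sp aA uv.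
Qed.

Let forward_count : count F A <= count (predC F) A * l.-1.
Proof.
have: \sum_(a <- A) (phi a.1 + F a) <= \sum_(a <- A) (phi a.2 + ~~ F a * l.-1).
  by rewrite !big_seq; apply: leq_sum => a; apply: back_step.
rewrite !big_split /= (balanced_sum phi bA) leq_add2l -big_distrl /=.
by rewrite -!sumn_count !sumnE !big_map.
Qed.

Let rk v := index v (sort (relpre phi leq) (enum S)).

Let rk_lt v : v \in S -> rk v < #|S|.
Proof. by move=> vS; rewrite cardE -(size_sort (relpre phi leq)) index_mem mem_sort mem_enum. Qed.

Let rk_mono u v : u \in S -> v \in S -> phi u < phi v -> rk u < rk v.
Proof.
move=> uS vS; apply: contraTT; rewrite -!leqNgt.
apply: (@sorted_leq_index _ (relpre phi leq)); rewrite ?mem_sort ?mem_enum //.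
- by move=> x y z /=; apply: leq_trans.
- by move=> x /=.
- by apply: sort_sorted => x y /=; apply: leq_total.
Qed.

Let rk_inj : {in S &, injective rk}.
Proof.
move=> u v uS vS; have : u \in sort (relpre phi leq) (enum S) by rewrite mem_sort mem_enum.
have : v \in sort (relpre phi leq) (enum S) by rewrite mem_sort mem_enum.
move=> vE uE; rewrite /rk => h.
by rewrite -[u](nth_index u uE) h nth_index.
Qed.

Let gap_sum : \sum_(a <- A | F a) (rk a.2 - rk a.1) <= count (predC F) A * #|S|.
Proof.
have: \sum_(a <- A) (rk a.1 + F a * (rk a.2 - rk a.1)) <= \sum_(a <- A) (rk a.2 + ~~ F a * #|S|).
  rewrite !big_seq; apply: leq_sum => a aA.
  have /allP/(_ a aA)/andP[a1 a2] := AS; have := rk_lt a1.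
  rewrite /F; case: (ltnP (phi a.1) (phi a.2)) => /= h; last by lia.
  by have := rk_mono a1 a2 h; lia.
rewrite !big_split /= (balanced_sum rk bA) leq_add2l -big_distrl /=.
rewrite -sumn_count sumnE big_map [X in _ -> X <= _]big_mkcond /=.
by under eq_bigr => a _ do rewrite mulnbl.
Qed.

Let forward_sqr : count F A ^ 2 <= #|S| * (2 * (count (predC F) A * #|S|)).
Proof.
apply: leq_trans (leq_mul (leqnn #|S|) (leq_mul (leqnn 2) gap_sum)).
(* Cauchy's inequality over the sources; at one source the rank gaps are distinct and positive, so
   the square of their number is at most twice their sum. *)
rewrite -sum1_count !sum_by_source; apply: leq_trans (sum_sqr_le _ _) _.
rewrite leq_mul // big_distrr /=; apply: leq_sum => u uS.
rewrite sum1_count -size_filter -[X in _ <= 2 * X]big_filter; set Fu := filter _ _.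
have := @sumn_uniq_pos [seq rk a.2 - rk a.1 | a <- Fu].
rewrite size_map sumnE big_map; apply.
- rewrite map_inj_in_uniq ?filter_uniq // => -[a1 a2] [b1 b2].
  rewrite !mem_filter /= /F /= => /andP[/andP[ua /eqP a1u] aA] /andP[/andP[ub /eqP b1u] bA'] h.
  rewrite {}a1u in ua aA h *; rewrite {}b1u in ub bA' h *.
  have /allP/(_ _ aA)/andP[/= _ aS] := AS; have /allP/(_ _ bA')/andP[/= _ bS] := AS.
  have ua' := rk_mono uS aS ua; have ub' := rk_mono uS bS ub; rewrite /= in h.
  suff -> : a2 = b2 by [].
  have h' : rk a2 = rk b2 by lia.
  exact: (rk_inj aS bS h').
- apply/allP => y /mapP[[a1 a2]]; rewrite mem_filter /F /= => /andP[/andP[ua _] aA] {y}->.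
  have /allP/(_ _ aA)/andP[/= a1S a2S] := AS.
  by have /= := rk_mono a1S a2S ua; lia.
Qed.

(** For [f] increasing and [b] other arcs and [s = #|S|], this multiplies [f + b <= s * l ^ 2] by
    [(f + b) ^ 2 <= 6 * (s ^ 3 * l)]. *)
Lemma cube_bound : l <= #|S| -> size A ^ 3 <= 6 * (#|S| ^ 4 * l ^ 3).
Proof.
move=> lS; have := forward_sqr; have := forward_count; have := back_count.
rewrite -(count_predC F A); move: (count F A) (count (predC F) A) lS => f b.
move: #|S| => s ls bl fl f2.
have m1 : f + b <= s * l ^ 2 by nia.
have bs : b ^ 2 <= s ^ 3 * l.
  have: b ^ 2 <= (s * l) ^ 2 by rewrite leq_exp2r.
  move=> h; apply: leq_trans h _; rewrite expnMn (expnSr s 2) -mulnA leq_mul //.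
  by rewrite (expnS l) expn1 leq_mul.
have fs : f ^ 2 <= 2 * (s ^ 3 * l).
  apply: leq_trans f2 _; apply: (@leq_trans (s * (2 * (s * l * s)))); last by apply: eq_leq; lia.
  by rewrite !leq_mul.
have m2 : (f + b) ^ 2 <= 6 * (s ^ 3 * l).
  have: (f + b) ^ 2 <= 2 * f ^ 2 + 2 * b ^ 2 by rewrite sqrnD; have [] := nat_Cauchy f b; lia.
  by lia.
rewrite expnS; apply: leq_trans (leq_mul m1 m2) _.
by rewrite mulnCA leq_mul // (expnS s 3) (expnSr l 2); apply: eq_leq; lia.
Qed.

End LongCycle.

Lemma long_cycle A (S : {set V}) a : uniq A -> loopless A -> balanced A -> arcs_in A S ->
  A != [::] -> #|S| <= a ^ 3 ->
  exists c, [/\ uniq c, c != [::], {subset cycle_arcs c <= A} &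
    size A <= 2 * a * #|S| * size c].
Proof.
move=> uA lA bA AS A0 Sa.
pose Q l := `[< exists c, [/\ uniq c, {subset cycle_arcs c <= A} & size c = l] >].
have Q0 : exists l, Q l by exists 0; apply/asboolP; exists [::].
have QS l : Q l -> l <= #|S|.
  case/asboolP => c [uc cA <-]; rewrite cardE uniq_leq_size // => v vc.
  have [w vw _] := cycle_arcs_mem vc; rewrite mem_enum.
  by have /allP/(_ _ (cA _ vw))/andP[] := AS.
case: (ex_maxnP Q0 QS) => l Ql lmax; have lS := QS l Ql.
have /asboolP[c [uc cA cl]] := Ql.
have cube : size A ^ 3 <= 6 * (#|S| ^ 4 * l ^ 3).
  apply: cube_bound => // d ud dA.
  by apply: lmax; apply/asboolP; exists d.
have A1 : 0 < size A by rewrite lt0n size_eq0.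
exists c; split => //.
  apply: contraTneq A1 => c0; move: cube; rewrite -cl c0 /= exp0n // !muln0.
  by rewrite leqn0 expn_eq0 andbT -leqNgt leqn0.
(* Cube root of the bound: [6 <= 2 ^ 3], and one of the four factors [#|S|] is at most [a ^ 3]. *)
rewrite cl -(@leq_exp2r _ _ 3) //; apply: leq_trans cube _.
rewrite !expnMn (expnS #|S| 3) !mulnA leq_mul // leq_mul //.
by rewrite -[2 ^ 3]/8 mulnAC; apply: leq_trans (leq_mul (leqnn _) Sa) _; lia.
Qed.

(* Half of [M] arcs are removed by [2 * a * #|S|] cycles. *)
Lemma peel_cycles A (S : {set V}) a M j : uniq A -> loopless A -> balanced A -> arcs_in A S ->
  #|S| <= a ^ 3 ->
  exists Cs B, [/\ all uniq Cs, perm_eq (flatten (map cycle_arcs Cs) ++ B) A, size Cs <= j &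
    (2 * size B <= M) || (2 * (2 * a * #|S|) * size B + j * M <= 2 * (2 * a * #|S|) * size A)].
Proof.
move=> + + + + Sa; elim: j A => [|j IH] A uA lA bA AS.
  by exists [::], A; rewrite perm_refl addn0 leqnn orbT.
case: (leqP (2 * size A) M) => AM.
  by exists [::], A; rewrite perm_refl AM.
have A0 : A != [::] by case: (A) AM.
have [c [uc c0 cA cS]] := long_cycle uA lA bA AS A0 Sa.
set A' := [seq e <- A | e \notin cycle_arcs c].
have pA : perm_eq (cycle_arcs c ++ A') A := perm_diff uA (uniq_cycle_arcs uc) cA.
have sA : size A = size c + size A'.
  rewrite -(perm_size pA) size_cat; congr (_ + _).
  by case: (c) => //= x p; rewrite size_zip /= size_rcons; lia.
have [||||Cs [B [uCs pB sCs h]]] := IH A'.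
- exact: filter_uniq.
- by apply/allP => e; rewrite mem_filter => /andP[_ /(allP lA)].
- by apply: balanced_catr (balanced_cycle c); apply: balanced_perm bA; rewrite perm_sym.
- by apply/allP => e; rewrite mem_filter => /andP[_ /(allP AS)].
exists (c :: Cs), B; split => //=; first by rewrite uc.
  by rewrite -catA (perm_trans _ pA) // perm_cat2l.
case/orP: h => [->//|h]; apply/orP; right.
move: cS h AM; rewrite sA; move: (2 * a * #|S|) (size A') (size B) (size c) => K x y z cS h AM.
have {AM}: M <= 2 * (K * z) by lia.
by move: h; rewrite mulSn mulnDr; lia.
Qed.

Lemma cycle_decomposition A (S : {set V}) a k : uniq A -> loopless A -> balanced A ->
  arcs_in A S -> #|S| <= a ^ 3 -> size A < 2 ^ k ->
  exists Cs, [/\ all uniq Cs, perm_eq (flatten (map cycle_arcs Cs)) A &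
    size Cs <= 2 * a * #|S| * k].
Proof.
move=> + + + + Sa; elim: k A => [|k IH] A uA lA bA AS sA.
  by exists [::]; case: (A) sA.
(* For nonempty [A], as [2 ^ k.+1 - 1] is at least [size A], both outcomes give [2 * size B] at most
   this number, so fewer than [2 ^ k] arcs remain. *)
have [Cs [B [uCs pB sCs h]]] := peel_cycles (2 ^ k.+1).-1 (2 * a * #|S|) uA lA bA AS Sa.
have sub : {subset B <= A} by move=> e eB; rewrite -(perm_mem pB) mem_cat eB orbT.
have bC : balanced (flatten (map cycle_arcs Cs)).
  elim: (Cs) => [|c Cs' IHc] //=; apply: balanced_cat IHc; exact: balanced_cycle.
have [|||||Cs' [uCs' pB' sCs']] := IH B.
- by have := perm_uniq pB; rewrite uA cat_uniq => /and3P[].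
- by apply/allP => e /sub /(allP lA).
- by apply: balanced_catr bC; apply: balanced_perm bA; rewrite perm_sym.
- by apply/allP => e /sub /(allP AS).
- case: (posnP (size A)) => [A0|A0].
    by move/eqP: A0; rewrite -(perm_size pB) size_cat addn_eq0 => /andP[_ /eqP->]; rewrite expn_gt0.
  have K0 : 0 < 2 * a * #|S|.
    have S0 : 0 < #|S|.
      case: (A) A0 AS => // e A' _ /andP[/andP[eS _] _].
      by apply/card_gt0P; exists e.1.
    by rewrite !muln_gt0 S0 andbT /=; case: (a) Sa => //; rewrite exp0n //; lia.
  move: h K0 sA; rewrite !expnS; move: (2 * a * #|S|) (2 ^ k) => K T; nia.
exists (Cs ++ Cs'); split; first by rewrite all_cat uCs.
  rewrite map_cat flatten_cat (perm_trans _ pB) //.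
  by rewrite perm_cat2l.
by rewrite size_cat mulnS leq_add.
Qed.

End Cycles.

(** * Path decompositions of balanced digraphs with few paths starting at each vertex *)

(** An item takes any candidate with load below [r]; if there is none, it is left over. Saturated
    vertices stay saturated. *)
Lemma greedy_assignment (T V : eqType) (cand : T -> seq V) r (s : seq T) :
  exists (f : seq (T * V)) (rest : seq T),
  [/\ perm_eq (map fst f ++ rest) s, {in f, forall x, x.2 \in cand x.1},
      forall v, count (fun x => x.2 == v) f <= r &
      {in rest, forall i, {in cand i, forall v, count (fun x => x.2 == v) f = r}}].
Proof.
elim: s => [|i s [f [rest [pf cf rf sat]]]]; first by exists [::], [::].
case: (boolP (has (fun v => count (fun x => x.2 == v) f < r) (cand i))) => [/hasP[v vi vr]|/hasPn h].
  exists ((i, v) :: f), rest; split => /=; first by rewrite perm_cons.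
  - by move=> x; rewrite inE => /predU1P[->|/cf].
  - by move=> w; have := rf w; case: eqP => [<- _|_]; rewrite ?add1n ?add0n.
  - move=> i' i'r w wi; have h := sat i' i'r w wi; rewrite h.
    by case: eqP => [vw|_]; [move: vr; rewrite vw h ltnn | rewrite add0n].
exists f, (i :: rest); split => //.
  by rewrite (perm_trans (y := i :: map fst f ++ rest)) ?perm_cons // -cat1s perm_catCA.
move=> i'; rewrite inE => /predU1P[->|/sat//] v /h; rewrite -leqNgt => h'.
by apply/eqP; rewrite eqn_leq rf h'.
Qed.

Lemma perm_flatten_map (T U : eqType) (f g : T -> seq U) (s : seq T) :
  {in s, forall x, perm_eq (f x) (g x)} -> perm_eq (flatten (map f s)) (flatten (map g s)).
Proof.
elim: s => [|x s IH] h //=; rewrite perm_cat ?h ?mem_head //.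
by apply: IH => y ys; apply: h; rewrite inE ys orbT.
Qed.

(** * Exchange of tails between closed pieces *)

Section Untangle.
Variable V : finType.
Implicit Types (A B : seq (V * V)) (p q c t : seq V) (P F R : seq (seq V)) (v x y : V).

(* A piece is a path, or a cycle cut open at one vertex, which is then both its
   first and its last entry. *)
Definition closed t := ohead t == ohead (rev t).

Definition piece t :=
  if t is x :: p then [&& p != [::], uniq p & (x \notin p) || (x == last x p)] else false.

(** Follow one piece up to [x] and then the other to its end. Both walks obtained join distinct
    roots, so they contain paths; arcs may be dropped, but starts and ends are kept. *)
Lemma swap_closed t1 t2 x : piece t1 -> piece t2 -> closed t1 -> closed t2 ->
  x \in t1 -> x \in t2 -> ohead t1 != ohead t2 -> uniq (path_arcs t1 ++ path_arcs t2) ->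
  exists q1 q2, [/\ piece q1, piece q2, ~~ closed q1 & ~~ closed q2] /\
  [/\ ohead q1 = ohead t1, ohead q2 = ohead t2, ohead (rev q1) = ohead (rev t2),
      ohead (rev q2) = ohead (rev t1) & uniq (path_arcs q1 ++ path_arcs q2) /\
      {subset path_arcs q1 ++ path_arcs q2 <= path_arcs t1 ++ path_arcs t2}].
Proof.
case: t1 => // y1 p1 /and3P[p10 up1 _]; case: t2 => // y2 p2 /and3P[p20 up2 _].
rewrite /closed !ohead_rev /= !(inj_eq Some_inj) => /eqP l1 /eqP l2 xt1 xt2 y12 ua.
(* If [x] is a root, it also occurs as the last entry of that piece, so the tail may be split at [x]
   in any case. *)
have inl y p : p != [::] -> y = last y p -> x \in y :: p -> x \in p.
  by case/lastP: p => // p z _; rewrite last_rcons inE => -> /orP[/eqP->|//]; rewrite mem_rcons mem_head.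
have xp1 := inl _ _ p10 l1 xt1; have xp2 := inl _ _ p20 l2 xt2.
case/splitPr: xp1 l1 ua {up1 p10 xt1} => a1 b1; case/splitPr: xp2 l2 {up2 p20 xt2} => a2 b2.
rewrite !last_cat /= => l2 l1.
rewrite -[y1 :: a1 ++ _]cat_cons -[y2 :: a2 ++ _]cat_cons !path_arcs_cat => ua.
have w1 : y1 != last y1 (a1 ++ x :: b2) by rewrite last_cat /= -l2.
have w2 : y2 != last y2 (a2 ++ x :: b1) by rewrite last_cat /= -l1 eq_sym.
have [q1 [uq1 q10 lq1 sq1]] := shorten_arcs w1.
have [q2 [uq2 q20 lq2 sq2]] := shorten_arcs w2.
rewrite -[y1 :: a1 ++ _]cat_cons path_arcs_cat in sq1.
rewrite -[y2 :: a2 ++ _]cat_cons path_arcs_cat in sq2.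
have pe : perm_eq (((path_arcs (rcons (y1 :: a1) x)) ++ path_arcs (x :: b2)) ++
    (path_arcs (rcons (y2 :: a2) x) ++ path_arcs (x :: b1)))
  ((path_arcs (rcons (y1 :: a1) x) ++ path_arcs (x :: b1)) ++
      path_arcs (rcons (y2 :: a2) x) ++ path_arcs (x :: b2)).
  by apply/permP => Q; rewrite !count_cat; lia.
have pq (y : V) q : uniq (y :: q) -> q != [::] -> piece (y :: q) by move=> /= /andP[-> ->] ->.
have lw1 : last y1 q1 = y2 by rewrite lq1 last_cat /= -l2.
have lw2 : last y2 q2 = y1 by rewrite lq2 last_cat /= -l1.
exists (y1 :: q1), (y2 :: q2); split; first split.
- exact: pq.
- exact: pq.
- by rewrite /closed ohead_rev lw1.
- by rewrite /closed ohead_rev lw2 (inj_eq Some_inj) eq_sym.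
rewrite !ohead_rev lw1 lw2 -l1 -l2; split => //; split.
  move: ua; rewrite -(perm_uniq pe) 2!cat_uniq => /and3P[_ dis _].
  rewrite !cat_uniq !uniq_arcs_of_uniq // andbT /=.
  apply: contra dis => /hasP[e e2 e1]; apply/hasP; exists e; first exact: sq2.
  exact: sq1.
move=> e; rewrite mem_cat -(perm_mem pe).
by case/orP => [/sq1|/sq2] h; rewrite mem_cat h ?orbT.
Qed.

(* In a choice with fewest closed pieces, two of them with different roots are
   disjoint: otherwise exchanging their tails would give two open pieces. *)
Lemma untangle R : all piece R -> uniq (arcs_of R) ->
  exists F, [/\ all piece F, uniq (arcs_of F), {subset arcs_of F <= arcs_of R},
    forall v, starts F v = starts R v & forall v, ends F v = ends R v] /\
  {in F &, forall t1 t2, closed t1 -> closed t2 -> forall x, x \in t1 -> x \in t2 -> ohead t1 = ohead t2}.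
Proof.
move=> pR uR.
pose good F := [/\ all piece F, uniq (arcs_of F), {subset arcs_of F <= arcs_of R},
    forall v, starts F v = starts R v & forall v, ends F v = ends R v].
have ex : exists k, `[< exists2 F, good F & count closed F = k >].
  by exists (count closed R); apply/asboolP; exists R => //; split.
case: (ex_minnP ex) => k /asboolP[F gF Fk] kmin; exists F; split => //.
move=> t1 t2 t1F t2F c1 c2 x x1 x2; apply/eqP/negPn/negP => t12.
have [pF uF sF stF enF] := gF.
have t2F' : t2 \in rem t1 F.
  have t21 : t2 != t1 by apply/eqP => h; move: t12; rewrite h eqxx.
  have: t2 \in t1 :: rem t1 F by rewrite -(perm_mem (perm_to_rem t1F)).
  by rewrite inE (negbTE t21).
set F' := rem t2 (rem t1 F).
have pe : perm_eq F (t1 :: t2 :: F').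
  by rewrite (permPl (perm_to_rem t1F)) perm_cons perm_to_rem.
have /= /and3P[pt1 pt2 pF'] : all piece (t1 :: t2 :: F') by rewrite -(perm_all _ pe).
have paF := perm_arcs_of pe.
have Ea q1 q2 : arcs_of (q1 :: q2 :: F') = (path_arcs q1 ++ path_arcs q2) ++ arcs_of F'.
  by rewrite /arcs_of /= catA.
have ua : uniq ((path_arcs t1 ++ path_arcs t2) ++ arcs_of F') by rewrite -Ea -(perm_uniq paF).
have [|q1 [q2 [[pq1 pq2 nq1 nq2] [h1 h2 h3 h4 [uq sq]]]]] := swap_closed pt1 pt2 c1 c2 x1 x2 t12.
  by move: ua; rewrite cat_uniq => /andP[].
have /kmin : `[< exists2 G, good G & count closed G = count closed (q1 :: q2 :: F') >].
  apply/asboolP; exists (q1 :: q2 :: F') => //; split.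
  - by rewrite /= pq1 pq2.
  - rewrite Ea cat_uniq uq; move: ua; rewrite cat_uniq => /and3P[_ dis ->]; rewrite andbT /=.
    by apply: contra dis => /hasP[e e1 /sq e2]; apply/hasP; exists e.
  - move=> e; rewrite Ea mem_cat => eE; apply: sF; rewrite (perm_mem paF) Ea mem_cat.
    by case/orP: eE => [/sq ->|->]; rewrite ?orbT.
  - by move=> v; rewrite -stF /starts (permP pe) /= h1 h2.
  - by move=> v; rewrite -enF /ends (permP pe) /= h3 h4 addnCA.
by rewrite -Fk (permP pe) /= c1 c2 (negbTE nq1) (negbTE nq2) !add1n !add0n ltnNge leqnSn.
Qed.

Lemma path_arcs_cut t i : i < size t ->
  path_arcs (take i.+1 t) ++ path_arcs (drop i t) = path_arcs t.
Proof.
case: t => // x t it; rewrite (take_nth x) // (drop_nth x) //.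
by rewrite -path_arcs_cat -drop_nth // cat_take_drop.
Qed.

End Untangle.

(** * Cutting cycles with bounded load, and iteration on the remaining arcs *)

Section LoadedDecomposition.
Variable V : finType.
Implicit Types (A B U : seq (V * V)) (p q c t : seq V) (P F R : seq (seq V)) (v : V) (S X : {set V}).

Definition proper p := uniq p && (1 < size p).

(** Both parts contain the vertex at position [i], so no arc is lost. *)
Definition cut t i := [:: take i.+1 t; drop i t].

Definition closure (x : V * seq V) := x.1 :: rcons x.2 x.1.

Lemma arcs_of_cut t i : i < size t -> arcs_of (cut t i) = path_arcs t.
Proof. by move=> it; rewrite /arcs_of /= cats0 path_arcs_cut. Qed.

(** Each cycle is given by its root, its other vertices and a second cut vertex among these. The
    successor in the position accounts for the root in front. *)
Lemma cut_closure (f : seq ((V * seq V) * V)) :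
  {in f, forall x, uniq (x.1.1 :: x.1.2) /\ x.2 \in x.1.2} ->
  let P := flatten [seq cut (closure x.1) (index x.2 x.1.2).+1 | x <- f] in
  [/\ all proper P, arcs_of P = flatten (map (fun x => path_arcs (closure x.1)) f) &
    forall v, starts P v = count (fun x => x.1.1 == v) f + count (fun x => x.2 == v) f].
Proof.
elim: f => [|[[y p] u] f IH] h //=.
have [|p1 p2 p3] := IH; first by move=> x xf; apply: h; rewrite inE xf orbT.
have [/= /andP[yp up] pu] := h _ (mem_head _ _).
have iu : index u p < size p by rewrite index_mem.
have tk : take (index u p).+1 (rcons p y) = take (index u p).+1 p.
  by rewrite -cats1 takel_cat.
split.
- rewrite /= p1 andbT /proper /closure /= tk !size_drop size_rcons.
  rewrite drop_uniq ?rcons_uniq ?yp // take_uniq // andbT.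
  rewrite (contra _ yp) ?size_takel //; last by move/mem_take.
  by rewrite /=; lia.
- have ai : arcs_of (cut (closure (y, p)) (index u p).+1) = path_arcs (closure (y, p)).
    by rewrite arcs_of_cut // /= size_rcons; lia.
  by rewrite -ai -p2 -arcs_of_cat.
- move=> v; rewrite /starts /= -/(starts _ v) p3.
  rewrite /closure /= !(inj_eq Some_inj).
  rewrite (drop_nth y) ?size_rcons; last by lia.
  by rewrite nth_rcons iu nth_index //= (inj_eq Some_inj); lia.
Qed.

(** A closed piece is cut after its first arc; without loops both parts are proper paths. The new
    start is the second vertex of the piece. *)
Lemma cut_pieces F : all (@piece V) F -> loopless (arcs_of F) ->
  let P := flatten [seq if closed t then cut t 1 else [:: t] | t <- F] in
  [/\ all proper P, arcs_of P = arcs_of F &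
    forall v, starts P v = starts F v + count (fun t => closed t && (ohead (behead t) == Some v)) F].
Proof.
elim: F => [|t F IH] //= /andP[pt pF].
move=> lP; have /andP[lt lF] : loopless (path_arcs t) && loopless (arcs_of F).
  by rewrite /loopless -all_cat.
have [p1 p2 p3] := IH pF lF.
case: t pt lt {lP} => // y [|u p] //= /andP[/andP[up uq] h] lt.
case: ifP => c; last first.
  split => [||v]; last by rewrite /starts /= -/(starts _ v) p3 addnA.
  - rewrite /= p1 andbT /proper /= up uq andbT /=.
    by case/orP: h => [->//|/eqP yl]; move: c; rewrite /closed ohead_rev /= {1}yl eqxx.
  - by rewrite -[LHS]/(path_arcs (y :: u :: p) ++ arcs_of _) p2.
have yu : y != u by move: lt => /= /andP[].
move: c; rewrite /closed ohead_rev /= (inj_eq Some_inj) => /eqP yl.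
split.
- rewrite /= p1 andbT /proper /= take0 mem_seq1 yu up uq /=.
  by case: p yl {h lt up uq} => //= yu'; rewrite yu' eqxx in yu.
- by rewrite -[_ :: _ :: _]/(cut (y :: u :: p) 1 ++ _) arcs_of_cat arcs_of_cut // p2.
- move=> v; rewrite /starts /= -/(starts _ v) p3 /=.
  by rewrite addnA addnACA.
Qed.

Lemma saturated_bound (T : eqType) (f : seq (T * V)) r :
  r * #|[set v | count (fun x => x.2 == v) f == r]| <= size f.
Proof.
apply: (@leq_trans (\sum_v count (fun x => x.2 == v) f)).
  rewrite mulnC -sum_nat_const big_mkcond /=; apply: leq_sum => v _.
  by rewrite inE; case: eqP => [->|].
elim: f => [|x f IH] /=; first by rewrite big1.
rewrite big_split /= -addn1 addnC leq_add // (bigD1 x.2) //= eqxx big1 // => v /negbTE.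
by rewrite eq_sym => ->.
Qed.

(* [X] consists of the vertices at which no further cycle may be cut. A cycle
   left with a single cut meets the complement of [X] only there, so all the arcs
   at its root outside [X] stay in the pieces produced by [untangle]. *)
Lemma cut_stage A S a k : uniq A -> loopless A -> balanced A -> arcs_in A S ->
  #|S| <= a ^ 3 -> size A < 2 ^ k -> A != [::] ->
  exists P U X, [/\ all proper P, perm_eq (arcs_of P ++ U) A,
    forall v, starts P v <= 3 * (8 * a * k), balanced U & arcs_in U X /\ 2 * #|X| <= #|S|].
Proof.
(* There are at most [2 * a * #|S| * k] cycles, so with this [r] each of the two greedy rounds
   saturates at most a quarter as many vertices as [S] has. *)
move=> uA lA bA AS Sa Ak A0; set r := 8 * a * k.
have [Cs [uCs pCs sCs]] := cycle_decomposition uA lA bA AS Sa Ak.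
have [f1 [rest1 [pf1 cf1 rf1 sat1]]] := greedy_assignment id r Cs.
have uniqC c : c \in Cs -> uniq c by move/(allP uCs).
have f1C x : x \in f1 -> uniq x.1 /\ x.2 \in x.1.
  move=> xf; split; last exact: cf1.
  by apply: uniqC; rewrite -(perm_mem pf1) mem_cat map_f.
pose L := [seq (x.2, unroot x.1 x.2) | x <- f1].
have uL y : y \in L -> uniq (y.1 :: y.2).
  by case/mapP => x /f1C[ux vx] ->; have [] := reroot ux vx.
have aL : perm_eq (flatten [seq path_arcs (closure y) | y <- L]) (flatten [seq cycle_arcs x.1 | x <- f1]).
  rewrite -map_comp; apply: perm_flatten_map => x /f1C[ux vx] /=.
  by have [] := reroot ux vx.
have cL v : count (fun y => y.1 == v) L <= r.
  by rewrite count_map; apply: rf1.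
(* The second round looks for a cut vertex other than the root. *)
have [f2 [rest2 [pf2 cf2 rf2 sat2]]] := greedy_assignment snd r L.
have f2L x : x \in f2 -> uniq (x.1.1 :: x.1.2) /\ x.2 \in x.1.2.
  move=> xf; split; last exact: cf2.
  by apply: uL; rewrite -(perm_mem pf2) mem_cat map_f.
have [prP1 aP1 sP1] := cut_closure f2L.
set P1 := flatten _ in prP1 aP1 sP1.
pose R := map closure rest2.
have aA Q : count Q A = count Q (arcs_of P1) + count Q (arcs_of R) +
    count Q (flatten (map (@cycle_arcs V) rest1)).
  rewrite -(permP pCs) -(permP (perm_flatten (perm_map _ pf1))) map_cat flatten_cat count_cat.
  rewrite -map_comp -(permP aL) -(permP (perm_flatten (perm_map _ pf2))) map_cat flatten_cat.
  by rewrite count_cat aP1 /arcs_of /R -!map_comp.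
have Rin y : y \in rest2 -> y \in L by move=> yr; rewrite -(perm_mem pf2) mem_cat yr orbT.
have cntR v : count (fun x : (V * seq V) * V => x.1.1 == v) f2 + starts R v = count (fun y => y.1 == v) L.
  rewrite -(permP pf2) count_cat count_map /starts /R count_map; congr (_ + _).
have pA : perm_eq (arcs_of P1 ++ (arcs_of R ++ flatten (map (@cycle_arcs V) rest1))) A.
  by apply/permP => Q; rewrite aA !count_cat addnA.
have uAll := uA; rewrite -(perm_uniq pA) !cat_uniq in uAll.
have uR : uniq (arcs_of R) by case/and3P: uAll => _ _ /andP[].
have RA : {subset arcs_of R <= A} by move=> e eR; rewrite -(perm_mem pA) !mem_cat eR orbT.
have pR : all (@piece V) R.
  apply/allP => _ /mapP[y /Rin/uL/= /andP[yp up] ->].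
  by rewrite /closure /= rcons_uniq yp up last_rcons eqxx orbT -size_eq0 size_rcons.
have [F [[pF uF FR sF eF] diffF]] := untangle pR uR.
have lF : loopless (arcs_of F) by apply/allP => e /FR/RA/(allP lA).
have [prP2 aP2 sP2] := cut_pieces pF lF.
set P2 := flatten _ in prP2 aP2 sP2.
(* The arcs dropped in untangling; together with the cycles that found no root they are left to the
   next stage. *)
pose rem := [seq e <- arcs_of R | e \notin arcs_of F].
have pRF : perm_eq (arcs_of F ++ rem) (arcs_of R) by apply: perm_diff.
pose U := flatten (map (@cycle_arcs V) rest1) ++ rem.
pose X := [set v | count (fun x => x.2 == v) f1 == r] :|: [set v | count (fun x => x.2 == v) f2 == r].
have starts_ends_R v : starts R v = ends R v.
  rewrite /starts /ends /R !count_map; apply: eq_count => y /=.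
  by rewrite ohead_rev last_rcons.
have bP1 : balanced (arcs_of P1).
  rewrite aP1; move=> v; elim: (f2) => [|x f IH] //=.
  rewrite outc_cat inc_cat IH; congr (_ + _).
  have := path_arcs_degree (closure x.1) v; rewrite /closure ohead_rev last_rcons /=.
  by move/addIn.
have bP2 : balanced (arcs_of P2).
  by rewrite aP2 => v; have := arcs_of_degree F v; rewrite sF eF starts_ends_R => /addIn.
have sP v : starts (P1 ++ P2) v <= 3 * r.
  rewrite starts_cat sP1 sP2 sF.
  rewrite addnACA cntR mulSn leq_add ?cL // mul2n -addnn leq_add //.
  (* Closed pieces through [v] have a common root [y], and at most [r] cycles are rooted at [y], so
     at most [r] pieces have [v] as second vertex. *)
  case: (boolP (has (fun t => closed t && (ohead (behead t) == Some v)) F)); last first.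
    by rewrite has_count -leqNgt leqn0 => /eqP->.
  have beh t : ohead (behead t) == Some v -> v \in t.
    by case: t => [|y [|u p]] //= /eqP[->]; rewrite !inE eqxx orbT.
  case/hasP => t tF /andP[ct vt].
  case: t tF ct vt => // y t tF ct vt.
  apply: (@leq_trans (starts F y)); last first.
    by rewrite sF; apply: leq_trans (cL y); rewrite -cntR leq_addl.
  rewrite (@eq_in_count _ _ (fun t => (ohead t == Some y) && (closed t && (ohead (behead t) == Some v)))).
    by apply: sub_count => t' /andP[].
  move=> t' t'F /=; case: andP => [[ct' vt']|]; last by rewrite andbF.
  by rewrite (diffF _ _ t'F tF ct' ct v) ?beh // eqxx.
have pAU : perm_eq (arcs_of (P1 ++ P2) ++ U) A.
  apply: perm_trans pA; apply/permP => Q.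
  rewrite /U arcs_of_cat aP2 !count_cat -(permP pRF Q) count_cat -!addnA.
  by congr (_ + (_ + _)); rewrite addnC.
exists (P1 ++ P2), U, X; split => //.
- by rewrite all_cat prP1.
- apply: (@balanced_catr _ (arcs_of (P1 ++ P2))); first by apply: balanced_perm bA; rewrite perm_sym.
  by rewrite arcs_of_cat; apply: balanced_cat.
split; last first.
  have X1 := saturated_bound f1 r; have X2 := saturated_bound f2 r.
  have s1 : size f1 <= size Cs by rewrite -(perm_size pf1) size_cat size_map leq_addr.
  have s2 : size f2 <= size f1.
    rewrite -[size f1](size_map (fun x => (x.2, unroot x.1 x.2))) -/L.
    by rewrite -(perm_size pf2) size_cat size_map leq_addr.
  have := leq_card_setU [set v | count (fun x => x.2 == v) f1 == r]
    [set v | count (fun x => x.2 == v) f2 == r].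
  rewrite -/X => -[XU _]; move: X1 X2 XU; set n1 := #|_|; set n2 := #|_| => X1 X2 XU.
  have r0 : 0 < a * k.
    have S0 : 0 < #|S|.
      case: (A) A0 AS => // e A' _ /andP[/andP[eS _] _].
      by apply/card_gt0P; exists e.1.
    rewrite muln_gt0; apply/andP; split; first by case: (a) Sa => //; rewrite exp0n // leqNgt S0.
    by case: (k) Ak => //; case: (A) A0.
  have c1 : 8 * (a * k) * n1 <= 2 * (a * k) * #|S|.
    rewrite mulnA -/r; apply: leq_trans X1 _; apply: leq_trans s1 _.
    by apply: leq_trans sCs _; rewrite mulnA mulnAC.
  have c2 : 8 * (a * k) * n2 <= 2 * (a * k) * #|S|.
    rewrite mulnA -/r; apply: leq_trans X2 _; apply: leq_trans s2 _.
    by apply: leq_trans s1 _; apply: leq_trans sCs _; rewrite mulnA mulnAC.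
  move: c1 c2; rewrite -!mulnA ![_ * (a * (k * _))]mulnA => c1 c2. clear -c1 c2 XU r0; nia.
apply/allP => e; rewrite /U mem_cat => /orP[/flattenP[_ /mapP[c cr ->]] ec|].
  have /andP[e1 e2] := mem_cycle_arcs ec.
  by rewrite !inE !(sat1 c cr) ?eqxx.
rewrite mem_filter => /andP[enF eR].
have key (g : V * V -> V) : (forall v, v \notin X ->
    count (fun e => g e == v) (arcs_of R) <= count (fun e => g e == v) (arcs_of F)) -> g e \in X.
  move=> h; apply/negPn/negP => gX; have := h _ gX.
  rewrite -(permP pRF) count_cat leqNgt => /negP; apply.
  rewrite -[X in X < _]addn0 ltn_add2l -has_count; apply/hasP; exists e => //=.
  by rewrite mem_filter enF.
have cnt_closure v : v \notin X -> forall y, y \in rest2 ->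
    outc (path_arcs (closure y)) v = (y.1 == v) /\ inc (path_arcs (closure y)) v = (y.1 == v).
  move=> vX y yr; have vy : v \notin y.2.
    apply: contra vX => vy; rewrite !inE; apply/orP; right.
    by rewrite (sat2 y yr).
  rewrite /outc /inc -(count_map fst (pred1 v)) -(count_map snd (pred1 v)).
  rewrite map_fst_path_arcs map_snd_path_arcs belast_rcons -cats1 count_cat /= addn0.
  by have /count_memPn -> := vy; rewrite addn0 add0n.
have cntRv v : v \notin X -> outc (arcs_of R) v = starts R v /\ inc (arcs_of R) v = starts R v.
  move=> vX; rewrite /R; have := cnt_closure v vX.
  elim: (rest2) => [|y s IH] h //=.
  have [h1 h2] := h y (mem_head _ _).
  have [|i1 i2] := IH; first by move=> z zs; apply: h; rewrite inE zs orbT.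
  rewrite /arcs_of /= -/(arcs_of _) outc_cat inc_cat h1 h2 i1 i2.
  by rewrite /starts /= (inj_eq Some_inj).
have outF v : starts F v <= outc (arcs_of F) v.
  elim: (F) pF => [|t F' IH] //= /andP[pt pF']; rewrite /arcs_of /= -/(arcs_of _) outc_cat.
  rewrite {1}/starts /= leq_add ?IH //.
  case: t pt => // y [|u p] //= _; rewrite (inj_eq Some_inj); exact: leq_addr.
have inF v : ends F v <= inc (arcs_of F) v.
  have /addIn <- : outc (arcs_of F) v + ends F v = inc (arcs_of F) v + ends F v.
    by rewrite arcs_of_degree sF eF starts_ends_R.
  by rewrite eF -starts_ends_R -sF.
rewrite (key fst) 1?(key snd) // => v vX.
  by have [_ h] := cntRv v vX; rewrite -/(inc _ v) h starts_ends_R -eF inF.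
by have [h _] := cntRv v vX; rewrite -/(outc _ v) h -sF outF.
Qed.

(** Each stage leaves arcs on at most half of the vertices, so [j] stages suffice and their loads
    add up. *)
Lemma loaded_decomposition a k j A S : uniq A -> loopless A -> balanced A -> arcs_in A S ->
  #|S| <= a ^ 3 -> #|S| < 2 ^ j -> size A < 2 ^ k ->
  exists P, [/\ all proper P, perm_eq (arcs_of P) A &
    forall v, starts P v <= j * (3 * (8 * a * k))].
Proof.
elim: j A S => [|j IH] A S uA lA bA AS Sa Sj Ak.
  exists [::]; split => //; case: A AS {uA lA bA Ak} => // e A /andP[/andP[e1 _] _].
  by move: Sj; rewrite ltnS leqn0 cards_eq0 => /eqP S0; rewrite S0 inE in e1.
case: (eqVneq A [::]) => [->|A0]; first by exists [::].
have [P [U [X [pP pU sP bU [UX XS]]]]] := cut_stage uA lA bA AS Sa Ak A0.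
have UA : {subset U <= A} by move=> e eU; rewrite -(perm_mem pU) mem_cat eU orbT.
have uU : uniq U by have := uA; rewrite -(perm_uniq pU) cat_uniq => /and3P[].
have lU : loopless U by apply/allP => e /UA/(allP lA).
have [|||Q [pQ aQ sQ]] := IH U X uU lU bU UX.
- by apply: leq_trans Sa; apply: leq_trans XS; clear; lia.
- by rewrite expnS in Sj; clear -Sj XS; lia.
- by apply: leq_ltn_trans Ak; rewrite -(perm_size pU) size_cat leq_addl.
exists (P ++ Q); split; first by rewrite all_cat pP.
  by rewrite arcs_of_cat; apply: perm_trans pU; rewrite perm_cat2l.
by move=> v; rewrite starts_cat mulSn leq_add.
Qed.

End LoadedDecomposition.

(** * Cutting paths so that they can be prolonged by reserved arcs *)

Section Repair.
Variables (V : finType) (Plus Minus : {set V}) (N M : V -> {set V}) (h D L : nat).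

(* [nb v] is the set of reserved neighbours that a path needs if it starts at
   [v \notin Plus] or ends at [v \in Plus]. *)
Definition nb v := if v \in Plus then M v else N v.

Hypothesis disj : [disjoint Plus & Minus].
Hypothesis N_Plus : forall v, v \notin Plus -> N v \subset Plus.
Hypothesis M_Minus : forall v, v \in Plus -> M v \subset Minus.
Hypothesis nb_card : forall v, 2 * h + 2 * D <= #|nb v|.
Hypothesis nb_sym : forall w z, w \in Minus -> z \in Plus -> (z \in N w) = (w \in M z).
Hypothesis nb_load : forall x, \sum_v (x \in nb v) <= L * D.
Hypothesis D0 : 0 < D.

(** * Walks between vertices of a single path *)

Section Walk.
Variable Q : seq V.

Definition btw v u := [set x in Q |
  minn (index v Q) (index u Q) <= index x Q <= maxn (index v Q) (index u Q)].

(** Walks go inward: a vertex outside [Plus] is a possible start of a piece and looks forward along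
    [Q], a vertex of [Plus] is a possible end and looks backward. *)
Definition dir v u := (u \in Q) &&
  (if v \in Plus then index u Q < index v Q else index v Q < index u Q).

(* The stretch of [Q] between [v] and [u] can be prolonged at [v] by at least [h]
   reserved arcs without closing up. *)
Definition far v u := h <= #|nb v :\: btw v u|.

Definition onward v := [set u in nb v | dir v u && far v u].

(* From [v], at least [D] steps either succeed or lead to a vertex from which
   the same holds with [k] decreased. *)
Fixpoint good k v := if k is k'.+1
  then D <= #|[set u in onward v | far u v || good k' u]| else false.

(** The state of a walk: it stands at [v], and the stretch from [v] to [e] contains too many
    reserved neighbours of [v]. *)
Definition tight e v := [&& v \in Q, dir v e & ~~ far v e].

Lemma btwC v u : btw v u = btw u v.
Proof. by apply/setP => x; rewrite !inE minnC maxnC. Qed.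

Lemma Minus_notin_Plus v : v \in Minus -> v \notin Plus.
Proof. by move=> vM; apply: contraTN vM => /(disjointFr disj) ->. Qed.

Lemma nb_side v u : u \in nb v -> (u \in Plus) = (v \notin Plus).
Proof.
rewrite /nb; case: (boolP (v \in Plus)) => vP uv /=; last exact: (subsetP (N_Plus vP)).
by apply/negbTE/Minus_notin_Plus/(subsetP (M_Minus vP)).
Qed.

Lemma nb_Minus v u : u \in nb v -> v \in Plus -> u \in Minus.
Proof. by rewrite /nb => + vP; rewrite vP; exact: (subsetP (M_Minus vP)). Qed.

Lemma dir_sym v u : v \in Q -> u \in nb v -> dir v u -> dir u v.
Proof. by rewrite /dir => -> /nb_side ->; case: (v \in Plus) => /andP[]. Qed.

Lemma nbC v u : v \in Plus :|: Minus -> u \in nb v -> v \in nb u.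
Proof.
move=> vPM uv; have := nb_side uv; move: uv vPM; rewrite inE /nb.
case: (boolP (v \in Plus)) => vP uv /= vM uP.
  by rewrite uP nb_sym // (subsetP (M_Minus vP)).
by rewrite uP -nb_sym.
Qed.

(** Let [v] be the one of these neighbours nearest to [u]. All others avoid the stretch from [u] to
    [v], and fewer than [h] can do so since [v] is not far. *)
Lemma few_near u : u \in Q -> #|[set v in nb u | dir u v && ~~ far u v]| <= h.
Proof.
move=> uQ; set Bd := [set v in nb u | _].
case: (set_0Vmem Bd) => [->|[v0 v0B]]; first by rewrite cards0.
pose dist v := maxn (index u Q) (index v Q) - minn (index u Q) (index v Q).
case: (arg_minnP dist v0B) => v vB vmin; have {}vB : v \in Bd := vB; rewrite (cardsD1 v) vB add1n.
have : ~~ far u v by move: vB; rewrite inE => /and3P[].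
rewrite -ltnNge; apply: leq_ltn_trans; apply: subset_leq_card.
apply/subsetP => x; rewrite in_setD1 => /andP[xv xB].
have := vmin x xB; move: vB xB; rewrite !inE => /and3P[vn dv _] /and3P[xn dx _].
rewrite xn andbT; move: dv dx; rewrite /dir => /andP[vQ dv] /andP[xQ dx] dist_le.
rewrite xQ /=; apply: contraNN xv => bt; apply/eqP.
suff ivx : index x Q = index v Q by rewrite -(nth_index u xQ) ivx nth_index.
move: dv dx dist_le bt; rewrite /dist; clear; case: (u \in Plus); lia.
Qed.

(** Of at least [2 * h + 2 * D] reserved neighbours, fewer than [h] avoid the stretch to [e], and at
    most [h] more are excluded by [few_near]. *)
Lemma many_onward e v : tight e v -> 2 * D <= #|onward v|.
Proof.
case/and3P => vQ de; rewrite /far -ltnNge => near.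
have := nb_card v; have := few_near vQ; set Bd := [set u in nb v | _] => nBd.
have sub : nb v \subset (nb v :\: btw v e) :|: (onward v :|: Bd).
  apply/subsetP => x xv; rewrite !inE xv /= andbT.
  case: (boolP ((x \in Q) && _)) => //= /andP[xQ bt].
  suff -> : dir v x by rewrite orbN.
  have xv' : index x Q <> index v Q.
    move=> E; have xvE : x = v by rewrite -(nth_index v xQ) E nth_index.
    by have := nb_side xv; rewrite xvE; case: (v \in Plus).
  move: de; rewrite /dir xQ => /andP[_] /=; move: bt xv'; clear.
  by case: (v \in Plus); lia.
have := subset_leq_card sub; have := leq_card_setU (nb v :\: btw v e) (onward v :|: Bd).
have := leq_card_setU (onward v) Bd; clear -nBd near.
by move=> [+ _] [+ _]; lia.
Qed.

(** An unsuccessful step continues the walk at [u], with [v] as the new far end. *)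
Lemma onward_tight v u : v \in Q -> u \in onward v -> ~~ far u v -> tight v u.
Proof.
move=> vQ; rewrite inE => /and3P[uv duv _] fuv; rewrite /tight fuv andbT.
by rewrite (dir_sym vQ uv duv) andbT; case/andP: duv.
Qed.

Lemma not_good_next v k : 2 * D <= #|onward v| -> ~~ good k.+1 v ->
  D <= #|[set u in onward v | ~~ far u v && ~~ good k u]|.
Proof.
rewrite /= -ltnNge => big small; have := cardsID [set u | far u v || good k u] (onward v).
have -> : onward v :&: [set u | far u v || good k u] = [set u in onward v | far u v || good k u].
  by apply/setP => u; rewrite !inE.
have -> : onward v :\: [set u | far u v || good k u] = [set u in onward v | ~~ far u v && ~~ good k u].
  by apply/setP => u; rewrite !inE negb_or andbC.
by move: big small; clear; lia.
Qed.

(* Unsuccessful steps expand: a state that is not good has at least [D] of them,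
   while by [few_near] each vertex is the target of at most [h]. *)
Lemma expansion k (T : {set V}) :
  {in T, forall v, [/\ v \in Plus :|: Minus, exists e, tight e v & ~~ good k v]} ->
  #|T| * D ^ k <= #|V| * h ^ k.
Proof.
elim: k T => [|k IH] T hT; first by rewrite !muln1 max_card.
pose step v u := (u \in onward v) && (~~ far u v && ~~ good k u).
pose T' := [set u | [exists v in T, step v u]].
have stepT v : v \in T -> D <= \sum_(u in T') step v u.
  move=> vT; have [_ [e te] ng] := hT v vT.
  apply: leq_trans (not_good_next (many_onward te) ng) _.
  rewrite -sum1_card big_mkcond /= [X in _ <= X]big_mkcond /=; apply: leq_sum => u _.
  case: ifP => //; rewrite inE => st; rewrite inE.
  suff -> : [exists v in T, step v u] by rewrite /step st.
  by apply/existsP; exists v; rewrite vT.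
have intoT u : u \in T' -> \sum_(v in T) step v u <= h.
  rewrite inE => /existsP[v0 /andP[v0T /andP[uo /andP[fu _]]]].
  have [_ [e /and3P[v0Q _ _]] _] := hT v0 v0T.
  have /and3P[uQ _ _] := onward_tight v0Q uo fu.
  apply: leq_trans (few_near uQ); rewrite -sum1_card big_mkcond /= [X in _ <= X]big_mkcond /=.
  apply: leq_sum => v _; case: ifP => // vT; case: (boolP (step v u)) => // /andP[uov /andP[fuv _]].
  have [vPM [e' /and3P[vQ _ _]] _] := hT v vT.
  have /and3P[_ duv _] := onward_tight vQ uov fuv.
  have uv : u \in nb v by move: uov; rewrite inE => /andP[].
  by rewrite inE (nbC vPM uv) duv fuv.
have /IH {}IH : {in T', forall u, [/\ u \in Plus :|: Minus, exists e, tight e u & ~~ good k u]}.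
  move=> u; rewrite inE => /existsP[v /andP[vT /andP[uo /andP[fu gu]]]].
  have [_ [e /and3P[vQ _ _]] _] := hT v vT; split => //; last by exists v; apply: onward_tight.
  move: uo; rewrite !inE => /andP[uv _]; have := nb_side uv.
  by case: (boolP (v \in Plus)) => [vP _|vP ->] //; rewrite (nb_Minus uv vP) orbT.
have : D * #|T| <= h * #|T'|.
  rewrite mulnC -sum_nat_const; apply: (@leq_trans (\sum_(v in T) \sum_(u in T') step v u)).
    exact: leq_sum.
  by rewrite exchange_big mulnC -sum_nat_const; apply: leq_sum.
move=> DT; rewrite expnS mulnA (mulnC #|T|) (expnS h) mulnCA; apply: leq_trans (leq_mul (leqnn h) IH).
by rewrite mulnA leq_mul.
Qed.

(** [expansion] requires states in [Plus] or [Minus], where the first vertex need not lie. One step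
    leads there, hence [k.+1]; then a single state that is not good contradicts the expansion. *)
Lemma tight_good k e v : #|V| * h ^ k < D ^ k -> tight e v -> good k.+1 v.
Proof.
move=> hk te; apply/negPn/negP => ng.
have := not_good_next (many_onward te) ng; case: (set_0Vmem [set u in onward v | ~~ far u v && ~~ good k u]).
  by move=> ->; rewrite cards0 leqNgt D0.
move=> [u]; rewrite inE => /and3P[uo fu gu] _.
have /and3P[vQ _ _] := te; have tu := onward_tight vQ uo fu.
have := @expansion k [set u]; rewrite cards1 mul1n leqNgt hk => H; suff: false by [].
apply: H => x /set1P->; split => //; last by exists v.
move: uo; rewrite !inE => /andP[uv _]; have := nb_side uv.
by case: (boolP (v \in Plus)) => [vP _|vP ->] //; rewrite (nb_Minus uv vP) orbT.
Qed.

(** Were [u] beyond [e], the stretch to [u] would contain the one to [e], and [v] would be far from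
    [e] as well. *)
Lemma dir_btw v u e : u \in nb v -> dir v e -> ~~ far v e -> dir v u -> far v u -> u \in btw v e.
Proof.
move=> uv de fe du fu; rewrite inE; case/andP: (du) => -> du' /=.
apply: contraNT fe => bt; apply: leq_trans fu _; apply: subset_leq_card.
apply: setDS; apply/subsetP => x; rewrite !inE => /andP[-> /=].
move: de du' bt; rewrite /dir => /andP[_]; clear.
by case: (v \in Plus); lia.
Qed.

Lemma btw_sub v u e : u \in btw v e -> btw v u \subset btw v e.
Proof.
rewrite inE => /andP[_ bu]; apply/subsetP => x; rewrite !inE => /andP[-> /=].
by move: bu; clear; lia.
Qed.

(** The stretch from [w] to [z] can be prolonged at both ends. The piece before [w], if any, ends in
    [Minus] and can be prolonged at [v]; the piece after [z] starts in [Plus]. *)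
Definition splits e v w z :=
  [/\ w \in Q, z \in Q, w \notin Plus, z \in Plus & index w Q < index z Q] /\
  [/\ h <= #|N w :\: btw w z|, h <= #|M z :\: btw w z|,
      w = v \/ w \in Minus & {in [:: w; z], forall c, c \in btw v e /\ (c = v \/ far v c)}].

End Walk.

(** In multiples of [m]: the current vertices have load [m], their successors [L * m], and the walk
    continues from the latter. *)
Fixpoint walk_cost k := if k is k'.+1 then 1 + L + L * walk_cost k' else 0.

(** One step is chosen on all paths at once by [bounded_assignment]: [x] is a candidate at most [m]
    times for each [y] having it as reserved neighbour, so at most [L * D * m] times. Paths whose
    step does not succeed enter the recursion. *)
Lemma walk_assignment (x0 : V) (I : finType) (Q : I -> seq V) k (P : pred I) (v e : I -> V) m :
  (forall i, P i -> tight (Q i) (e i) (v i) /\ good (Q i) k (v i)) ->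
  (forall x, \sum_(i | P i) (v i == x) <= m) ->
  exists w z : I -> V, (forall i, P i -> splits (Q i) (e i) (v i) (w i) (z i)) /\
    (forall x, \sum_(i | P i) ((w i == x) + (z i == x)) <= walk_cost k * m).
Proof.
elim: k P v e m => [|k IH] P v e m tg vm.
  exists v, v; split=> [i /tg[]//|x]; rewrite big1 // => i /tg[_] //.
pose cand i := [set u in onward (Q i) (v i) | far (Q i) u (v i) || good (Q i) k u].
have [||u [uc ul]] := @bounded_assignment I V P cand x0 D (L * m) D0.
- by move=> i /tg[].
- move=> x; rewrite mulnA (mulnC D); apply: leq_trans (leq_mul (nb_load x) (leqnn m)).
  rewrite big_distrl /=.
  apply: (@leq_trans (\sum_y \sum_(i | P i) (x \in nb y) * (v i == y))); last first.
    by apply: leq_sum => y _; rewrite -big_distrr leq_mul.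
  rewrite exchange_big /=; apply: leq_sum => i Pi.
  rewrite (bigD1 (v i)) //= eqxx muln1; apply: leq_trans (leq_addr _ _).
  by rewrite !inE; case: (x \in nb (v i)); rewrite ?leq_b1.
pose P2 i := P i && ~~ far (Q i) (u i) (v i).
have uon i : P i -> u i \in onward (Q i) (v i) by move=> /uc; rewrite inE => /andP[].
have [||w [z [wz wzl]]] := IH P2 u v (L * m).
- move=> i /andP[Pi fi]; have [/and3P[vQ _ _] _] := tg i Pi; split.
    exact: onward_tight (uon i Pi) fi.
  by have := uc i Pi; rewrite inE (negbTE fi) => /andP[].
- move=> x; apply: leq_trans (ul x); rewrite /load big_mkcondr /=.
  by apply: leq_sum => i _; case: ifP.
(* After a successful step the stretch between [v i] and [u i] is used, its vertex in [Plus] being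
   the later one on the path. *)
pose wl i := if P2 i then w i else if v i \in Plus then u i else v i.
pose zr i := if P2 i then z i else if v i \in Plus then v i else u i.
exists wl, zr; split=> [i Pi|x]; last first.
  apply: (@leq_trans (\sum_(i | P i) ((v i == x) + (u i == x)) +
      \sum_(i | P2 i) ((w i == x) + (z i == x)))).
    rewrite /P2 [X in _ <= _ + X]big_mkcondr -big_split /=; apply: leq_sum => i Pi.
    rewrite /wl /zr /P2 Pi /=; case: ifP => // _; first by rewrite leq_addl.
    by rewrite addn0; case: ifP => // _; rewrite addnC.
  rewrite /= big_split /= 2!mulnDl mul1n; apply: leq_add; first exact: leq_add (vm x) (ul x).
  by apply: leq_trans (wzl x) _; rewrite mulnA (mulnC L).
have [te _] := tg i Pi; have /and3P[vQ de fe] := te.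
have := uon i Pi; rewrite inE => /and3P[uv du fu].
have ub := dir_btw uv de fe du fu.
rewrite /wl /zr; case: ifP => P2i.
  have [s1 [s2 s3 s4 s5]] := wz i P2i; split=> //; split => //.
    right; case: s4 => // wu; case: s1 => _ _ wP _ _; rewrite wu in wP *.
    by apply: (nb_Minus uv); move: wP; rewrite (nb_side uv) negbK.
  move=> c /s5[cb _]; rewrite btwC in cb; split; first exact: subsetP (btw_sub ub) _ cb.
  right; apply: leq_trans fu _; apply: subset_leq_card; apply: setDS.
  exact: btw_sub cb.
have fuv : far (Q i) (u i) (v i) by move: P2i; rewrite /P2 Pi => /negbFE.
have uQ : u i \in Q i by case/andP: du.
have vb : v i \in btw (Q i) (v i) (e i).
  rewrite inE vQ; move: de; rewrite /dir => /andP[_]; clear; case: (_ \in Plus); lia.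
move: du; rewrite /dir uQ /= => du; have us := nb_side uv.
move: fu fuv du us; rewrite /far [btw _ (u i) _]btwC /nb.
case: (boolP (v i \in Plus)) => vP /= fu fuv du us.
  rewrite (negbTE (negbT us)) in fuv; rewrite [btw _ (v i) _]btwC in fu fuv.
  split; split => //; first by rewrite us.
    by right; apply: nb_Minus uv vP.
  move=> c; rewrite mem_seq2 => /orP[]/eqP->; last by split; [|left].
  by split=> //; right; rewrite /far /nb vP btwC.
rewrite us in fuv; split; split => //; first by left.
move=> c; rewrite mem_seq2 => /orP[]/eqP->; first by split; [|left].
by split=> //; right; rewrite /far /nb (negbTE vP).
Qed.

(** * Cutting the paths at the vertices found *)

Definition start_ok t :=
  if t is x :: _ then (x \in Plus) || (h <= #|N x :\: [set y in t]|) else true.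
Definition end_ok t :=
  if ohead (rev t) is Some x then (x \in Minus) || (h <= #|M x :\: [set y in t]|) else true.

(** Adjacent pieces share their cut vertex; an outer piece that would have no arc is left out. *)
Definition split_at (t : seq V) i j :=
  (if i == 0 then [::] else [:: take i.+1 t]) ++ take (j - i).+1 (drop i t) ::
  (if j.+1 == size t then [::] else [:: drop j t]).

Lemma arcs_of_split_at t i j : i < j < size t -> arcs_of (split_at t i j) = path_arcs t.
Proof.
case/andP => ij js; rewrite /split_at arcs_of_cat.
rewrite -(path_arcs_cut (ltn_trans ij js)); congr (_ ++ _).
  case: eqP => [->|_]; last by rewrite /arcs_of /= cats0.
  by case: (t) => // y [|u s].
rewrite -[RHS](@path_arcs_cut _ _ (j - i)) ?size_drop; last by lia.
rewrite /arcs_of /= drop_drop subnK 1?ltnW //; congr (_ ++ _).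
case: eqP => [E|_]; last by rewrite /= cats0.
case: t js E => // y s _ E; rewrite (drop_nth y) -?E // drop_oversize ?E //.
Qed.

Lemma mem_drop_index (t : seq V) y k : uniq t -> y \in drop k t -> k <= index y t.
Proof.
move=> ut yd; rewrite leqNgt; apply/negP => lt; move: ut.
rewrite -(cat_take_drop k t) cat_uniq => /and3P[_ /hasP[]]; exists y => //.
by rewrite /= in_take // (mem_drop yd).
Qed.

Lemma mem_middle (t : seq V) y i j : uniq t -> i <= j -> y \in take (j - i).+1 (drop i t) ->
  [/\ y \in t, i <= index y t & index y t <= j].
Proof.
move=> ut ij ym; have yd := mem_take ym; split; [exact: mem_drop yd|exact: mem_drop_index yd|].
move: ym; rewrite take_drop addSn subnK // => /mem_drop ym.
by have := in_take j.+1 (mem_take ym); rewrite ym ltnS => <-.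
Qed.

Lemma ohead_take (T : Type) (t : seq T) k : ohead (take k.+1 t) = ohead t.
Proof. by case: t. Qed.

Lemma ohead_drop_index (t : seq V) y : y \in t -> ohead (drop (index y t) t) = Some y.
Proof. by move=> yt; rewrite (drop_nth y) ?index_mem //= nth_index. Qed.

Lemma ohead_rev_take (t : seq V) y : y \in t -> ohead (rev (take (index y t).+1 t)) = Some y.
Proof. by move=> yt; rewrite (take_nth y) ?index_mem // rev_rcons nth_index. Qed.

Lemma split_at_ok e v w z t : uniq t -> ~~ start_ok t -> ohead t = Some v ->
  v \notin Plus -> splits t e v w z ->
  all start_ok (split_at t (index w t) (index z t)) /\
  (end_ok t -> all end_ok (split_at t (index w t) (index z t))).
Proof.
move=> ut nst hv vP [[wt zt wP zP wz] [Nw Mz wM fz]].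
have zM : z \notin Minus by apply: contraTN zP; apply: Minus_notin_Plus.
have mid y : y \in take (index z t - index w t).+1 (drop (index w t) t) -> y \in btw t w z.
  move=> /(mem_middle ut (ltnW wz)) [yt iy yj]; rewrite inE yt /=.
  by rewrite (minn_idPl (ltnW wz)) (maxn_idPr (ltnW wz)) iy.
have v0 : index v t = 0 by case: (t) hv => //= y s [->]; rewrite eqxx.
split; [|move=> et]; rewrite /split_at all_cat /= ; apply/and3P; split.
- case: eqP => //= /eqP i0; rewrite andbT.
  have [|_ [wv|fw]] := fz w; first by rewrite mem_head.
    by rewrite wv v0 in i0.
  have := ohead_take t (index w t); rewrite hv /start_ok.
  have sub : {subset take (index w t).+1 t <= btw t v w}.
    move=> y yt; rewrite inE v0 min0n max0n (mem_take yt) /=.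
    by have := in_take (index w t).+1 (mem_take yt); rewrite yt ltnS => <-.
  case: (take _ t) sub => // y s sub [yv]; subst y; rewrite (negbTE vP) /=.
  move: fw; rewrite /far /nb (negbTE vP) => fw; apply: leq_trans fw _.
  apply/subset_leq_card/setDS/subsetP => x; rewrite in_set; exact: sub.
- have := ohead_take (drop (index w t) t) (index z t - index w t).
  rewrite ohead_drop_index //; move: mid; rewrite /start_ok.
  case: (take _ _) => // y s mid [yw]; subst y; rewrite (negbTE wP) /=; apply: leq_trans Nw _.
  apply/subset_leq_card/setDS/subsetP => x; rewrite in_set; exact: mid.
- case: eqP => //= _; rewrite andbT; have := ohead_drop_index zt; rewrite /start_ok.
  by case: (drop _ t) => // y s [->]; rewrite zP.
- case: eqP => //= /eqP i0; rewrite andbT /end_ok ohead_rev_take //.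
  case: wM => [wv|->//]; by rewrite wv v0 in i0.
- rewrite /end_ok (take_nth z); last by rewrite size_drop; move: zt wz; rewrite -index_mem; clear; lia.
  rewrite rev_rcons nth_drop subnKC ?(ltnW wz) // nth_index //= (negbTE zM) /=.
  apply: leq_trans Mz _; apply/subset_leq_card/setDS/subsetP => x; rewrite inE => xm.
  apply: mid; rewrite (take_nth z).
    by rewrite nth_drop subnKC ?(ltnW wz) // nth_index.
  by rewrite size_drop; move: zt wz; rewrite -index_mem; clear; lia.
- case: eqP => //= _; rewrite andbT; move: et; rewrite /end_ok rev_drop.
  have -> : ohead (take (size t - index z t) (rev t)) = ohead (rev t).
    have: 0 < size t - index z t by rewrite subn_gt0 index_mem.
    by case: (_ - _) => // k _; apply: ohead_take.
  case: (ohead (rev t)) => // q; case: (q \in Minus) => //= hq.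
  apply: leq_trans hq _; apply/subset_leq_card/setDS/subsetP => x; rewrite !inE; exact: mem_drop.
Qed.

(** Only paths with a bad start are cut, and each cut adds a start at [w] or [z]; these are spread
    by [walk_assignment]. *)
Lemma repair_starts (m k : nat) (T : seq (seq V)) : #|V| * h ^ k < D ^ k ->
  all (@proper V) T -> (forall x, starts T x <= m) ->
  exists T', [/\ all (@proper V) T', perm_eq (arcs_of T') (arcs_of T),
    forall x, starts T' x <= (1 + walk_cost k.+1) * m, all start_ok T' & all end_ok T -> all end_ok T'].
Proof.
move=> hk pT sT.
case: (eqVneq T [::]) => [->|T0]; first by exists [::].
have [x0 _] : exists x0 : V, True.
  by case: T T0 pT {sT} => // -[//|x0 s] T _ _; exists x0.
pose Q (i : 'I_(size T)) := nth [::] T i.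
have QT i : Q i \in T by apply: mem_nth.
pose P i := ~~ start_ok (Q i).
pose v i := head x0 (Q i); pose e i := last x0 (Q i).
(* A bad start is a tight state whose stretch is the whole path. *)
have tg i : P i -> tight (Q i) (e i) (v i) /\ good (Q i) k.+1 (v i).
  move=> Pi; suff te : tight (Q i) (e i) (v i) by split=> //; apply: tight_good hk te.
  move: Pi; have := allP pT _ (QT i); rewrite /P /tight /v /e.
  case: (Q i) => // p [|q t]; first by rewrite /proper andbF.
  case/andP => ut _; rewrite [start_ok _]/= negb_or -ltnNge => /andP[pP Nh].
  set R := p :: q :: t in ut Nh *.
  have ip : index p R = 0 by rewrite /R /= eqxx.
  have il : index (last q t) R = (size t).+1 := index_last ut.
  have lR : last q t \in R by rewrite /R inE mem_last orbT.
  rewrite /tight /= mem_head /= /dir lR (negbTE pP) ip il /=.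
  rewrite /far /nb (negbTE pP) -ltnNge.
  suff -> : btw R p (last q t) = [set y in R] by [].
  apply/setP => y; rewrite !in_set ip il min0n max0n /=.
  by case: (boolP (y \in R)) => //=; rewrite -index_mem ltnS => ->.
have vP i : P i -> v i \notin Plus.
  by rewrite /P /v; case: (Q i) => // p t /=; rewrite negb_or => /andP[].
have vm x : \sum_(i | P i) (v i == x) <= m.
  apply: leq_trans (sT x); rewrite /starts -sum1_count (big_nth [::]) big_mkord.
  rewrite big_mkcond [X in _ <= X]big_mkcond /=; apply: leq_sum => i _.
  case: ifP => // Pi; rewrite /v -/(Q i); have := allP pT _ (QT i).
  by case: (Q i) => // p t _ /=; rewrite (inj_eq Some_inj); case: eqP.
have [w [z [wz wzm]]] := walk_assignment x0 tg vm.
have uQ i : uniq (Q i) by have /andP[] := allP pT _ (QT i).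
have hv i : ohead (Q i) = Some (v i).
  by rewrite /v; have := allP pT _ (QT i); case: (Q i).
pose cuts i := if P i then split_at (Q i) (index (w i) (Q i)) (index (z i) (Q i)) else [:: Q i].
have pcuts i : P i -> index (w i) (Q i) < index (z i) (Q i) < size (Q i).
  by move=> /wz[[wQ zQ _ _ ->] _]; rewrite index_mem.
have split_ok i (Pi : P i) := split_at_ok (uQ i) Pi (hv i) (vP i Pi) (wz i Pi).
exists (flatten [seq cuts i | i <- enum 'I_(size T)]).
have TE : T = [seq Q i | i <- enum 'I_(size T)].
  by rewrite -[LHS](mkseq_nth [::]) /mkseq -val_enum_ord -map_comp.
split.
- apply/allP => t /flattenP[_ /mapP[i _ ->]]; rewrite /cuts.
  have pQ := allP pT _ (QT i); case: (boolP (P i)) => Pi; last by rewrite inE => /eqP->.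
  have {}pQ := uQ i; case/andP: (pcuts i Pi) => ij js.
  rewrite /split_at mem_cat inE => /or3P[|/eqP->|].
  + case: eqP => // /eqP i0; rewrite mem_seq1 => /eqP->.
    by rewrite /proper take_uniq // size_takel; move: i0 ij js; clear; lia.
  + rewrite /proper take_uniq ?drop_uniq // size_takel ?size_drop; move: ij js; clear; lia.
  + case: eqP => // /eqP i0; rewrite mem_seq1 => /eqP->.
    by rewrite /proper drop_uniq // size_drop; move: i0 ij js; clear; lia.
- rewrite [X in perm_eq _ (arcs_of X)]TE; elim: (enum _) => [|i s IH] //=.
  rewrite arcs_of_cat perm_cat //; rewrite /cuts; case: (boolP (P i)) => Pi.
    by rewrite arcs_of_split_at // pcuts.
  by rewrite /arcs_of /= cats0.
- move=> x; rewrite mulnDl mul1n.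
  apply: (@leq_trans (starts T x + \sum_(i | P i) ((w i == x) + (z i == x)))); last exact: leq_add.
  have -> : starts T x = \sum_(i < size T) (ohead (Q i) == Some x).
    by rewrite {1}/starts [X in count _ X]TE count_map -sumn_count sumnE big_map big_enum.
  rewrite /starts count_flatten sumnE -map_comp big_map big_enum /=.
  rewrite [X in _ + X]big_mkcond -big_split /=; apply: leq_sum => i _.
  rewrite /cuts; case: (boolP (P i)) => Pi /=; last by rewrite addn0.
  have [[wQ zQ _ _ _] _] := wz i Pi.
  rewrite /split_at count_cat /= ohead_take ohead_drop_index // (inj_eq Some_inj).
  apply: leq_add; first by case: eqP => //= _; rewrite ohead_take addn0.
  rewrite leq_add2l; case: eqP => //= _.
  by rewrite ohead_drop_index // (inj_eq Some_inj) addn0.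
- apply/allP => t /flattenP[_ /mapP[i _ ->]]; rewrite /cuts.
  case: (boolP (P i)) => Pi; last by rewrite inE => /eqP->; rewrite -[start_ok _]negbK.
  by move: t; apply/allP; have [] := split_ok i Pi.
move=> eT; apply/allP => t /flattenP[_ /mapP[i _ ->]]; rewrite /cuts.
have eQ := allP eT _ (QT i).
case: (boolP (P i)) => Pi; last by rewrite inE => /eqP->.
by move: t; apply/allP; have [_] := split_ok i Pi; apply.
Qed.

End Repair.

(** * Excess *)

Section Flow.
Variable V : finType.
Implicit Types (A B : seq (V * V)) (P : seq (seq V)) (v : V).

Definition from_to (src snk : pred V) (t : seq V) := oapp src true (ohead t) && oapp snk true (ohead (rev t)).

Lemma from_to_sub (src src' snk snk' : pred V) t : subpred src src' -> subpred snk snk' ->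
  from_to src snk t -> from_to src' snk' t.
Proof.
move=> hs hk /andP[ht rt]; apply/andP; split; first by case: (ohead t) ht => //= x; apply: hs.
by case: (ohead _) rt => //= x; apply: hk.
Qed.

Lemma sum_outc A (T : {set V}) : \sum_(v in T) outc A v = count (fun e => e.1 \in T) A.
Proof.
elim: A => [|e A IH] /=; first by rewrite big1.
rewrite /outc /= big_split /= -/(outc _ _) IH; congr (_ + _).
case: (boolP (e.1 \in T)) => eT; last first.
  by rewrite big1 // => v vT; case: eqP => // ev; rewrite ev vT in eT.
by rewrite (bigD1 e.1) //= eqxx big1 // => v /andP[_ /negbTE]; rewrite eq_sym => ->.
Qed.

Lemma sum_inc A (T : {set V}) : \sum_(v in T) inc A v = count (fun e => e.2 \in T) A.
Proof.
elim: A => [|e A IH] /=; first by rewrite big1.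
rewrite /inc /= big_split /= -/(inc _ _) IH; congr (_ + _).
case: (boolP (e.2 \in T)) => eT; last first.
  by rewrite big1 // => v vT; case: eqP => // ev; rewrite ev vT in eT.
by rewrite (bigD1 e.2) //= eqxx big1 // => v /andP[_ /negbTE]; rewrite eq_sym => ->.
Qed.

Lemma balanced_of_outc_le A : (forall v, outc A v <= inc A v) -> balanced A.
Proof.
move=> le v; apply/eqP; rewrite eqn_leq le leqNgt; apply/negP => lt.
have := sum_outc A setT; have := sum_inc A setT.
rewrite (eq_count (a2 := predT)) => [|e]; last by rewrite !inE.
rewrite (eq_count (a2 := predT)) => [<-|e]; last by rewrite !inE.
apply/eqP; rewrite neq_ltn; apply/orP; left.
rewrite (bigD1 v) //= [X in _ < X](bigD1 v) //= -addSn leq_add //.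
by apply: leq_sum.
Qed.

(** No arc leaves the set reachable from a vertex of positive excess, so this set contains a vertex
    of negative excess. Removing a path between them moves both excesses towards zero, so later
    paths still join sources to sinks of [A]. *)
Lemma flow_decomposition A : uniq A ->
  exists P B, [/\ all (@proper V) P, perm_eq (arcs_of P ++ B) A, balanced B &
    all (from_to (fun v => inc A v < outc A v) (fun v => outc A v < inc A v)) P].
Proof.
have [n] := ubnP (size A); elim: n A => // n IH A; rewrite ltnS => An uA.
case: (boolP [exists v, inc A v < outc A v]) => [/existsP[v vA]|]; last first.
  move/existsPn => h; exists [::], A; split=> //.
  by apply: balanced_of_outc_le => v; rewrite leqNgt.
pose e : rel V := fun u w => (u, w) \in A.
pose T := [set y | connect e v y].
have vT : v \in T by rewrite inE connect0.
have [y yT yA] : exists2 y, y \in T & outc A y < inc A y.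
  case: (boolP [exists y in T, outc A y < inc A y]) => [/exists_inP//|/exists_inPn h].
  suff: False by [].
  have : \sum_(w in T) outc A w <= \sum_(w in T) inc A w.
    rewrite sum_outc sum_inc (@eq_in_count _ _ (fun a => (a.2 \in T) && (a.1 \in T))).
      by apply: sub_count => a /andP[].
    move=> [u w] uw /=; case: (boolP (u \in T)) => uT; last by rewrite andbF.
    rewrite andbT; apply/esym; rewrite inE (connect_trans (y := u)) //.
      by move: uT; rewrite inE.
    exact: connect1.
  rewrite leqNgt => /negP; apply.
  rewrite (bigD1 v) //= [X in _ < X](bigD1 v) //= -addSn leq_add // leq_sum // => w /andP[wT _].
  by rewrite leqNgt h.
move: yT; rewrite inE => /connectP[p pp yp]; move: yp.
case/shortenP: pp => q pq uq _ yq.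
have qA : {subset path_arcs (v :: q) <= A} by move=> [a b]; move: pq; rewrite path_arcsE => /allP h /h.
have uqa : uniq (path_arcs (v :: q)) := uniq_arcs_of_uniq uq.
set A' := [seq a <- A | a \notin path_arcs (v :: q)].
have pA : perm_eq (path_arcs (v :: q) ++ A') A := perm_diff uA uqa qA.
have q0 : q != [::] by apply: contraTneq yA => q0; rewrite yq q0 /= -leqNgt ltnW.
have sA' : size A' < size A.
  rewrite -(perm_size pA) size_cat -[X in X < _]add0n ltn_add2r.
  by case: (q) q0.
have [P [B [pP pB bB sP]]] := IH A' (leq_trans sA' An) (filter_uniq _ uA).
have deg x : outc A x + inc A' x + (x == y) = inc A x + outc A' x + (x == v).
  have := path_arcs_degree (v :: q) x; rewrite ohead_rev -yq /= !(inj_eq Some_inj).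
  rewrite -(outc_perm x pA) -(inc_perm x pA) outc_cat inc_cat (eq_sym y) (eq_sym v).
  by clear; lia.
exists ((v :: q) :: P), B; split => //.
- by rewrite /= pP andbT /proper uq /=; case: (q) q0.
- by rewrite /arcs_of /= -catA (perm_trans _ pA) // perm_cat2l.
rewrite /= {1}/from_to ohead_rev -yq /= vA yA /=.
apply: sub_all sP => t; rewrite /from_to; case: (ohead t) (ohead (rev t)) => [x|] [z|] //=.
- move=> /andP[hx hz]; apply/andP; split.
    by move: (deg x) hx vA yA; case: (eqVneq x y) => [->|_]; case: eqP => [->|_]; clear; lia.
  by move: (deg z) hz vA yA; case: (eqVneq z y) => [->|_]; case: eqP => [->|_]; clear; lia.
- rewrite !andbT => hx.
  by move: (deg x) hx vA yA; case: (eqVneq x y) => [->|_]; case: eqP => [->|_]; clear; lia.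
- move=> hz.
  by move: (deg z) hz vA yA; case: (eqVneq z y) => [->|_]; case: eqP => [->|_]; clear; lia.
Qed.

Lemma sum_starts_le P : \sum_v starts P v <= size P.
Proof.
elim: P => [|p P IH] /=; first by rewrite big1.
rewrite /starts /= big_split /= -/(starts _ _) -add1n leq_add //.
case: (ohead p) => [x|]; last by rewrite big1.
rewrite (bigD1 x) //= eqxx big1 // => v /negbTE; rewrite (inj_eq Some_inj) eq_sym.
by move=> ->.
Qed.

Lemma sum_ends_le P : \sum_v ends P v <= size P.
Proof.
elim: P => [|p P IH] /=; first by rewrite big1.
rewrite /ends /= big_split /= -/(ends _ _) -add1n leq_add //.
case: (ohead _) => [x|]; last by rewrite big1.
rewrite (bigD1 x) //= eqxx big1 // => v /negbTE; rewrite (inj_eq Some_inj) eq_sym.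
by move=> ->.
Qed.

Lemma sum_starts P : all (@proper V) P -> \sum_v starts P v = size P.
Proof.
elim: P => [|p P IH] /=; first by rewrite big1.
move=> /andP[pp pP]; rewrite /starts /= big_split /= -/(starts _ _) IH // -add1n; congr (_ + _).
case: p pp => // x p _; rewrite (bigD1 x) //= eqxx big1 // => v /negbTE.
by rewrite (inj_eq Some_inj) eq_sym => ->.
Qed.

Lemma sum_ends P : all (@proper V) P -> \sum_v ends P v = size P.
Proof.
elim: P => [|p P IH] /=; first by rewrite big1.
move=> /andP[pp pP]; rewrite /ends /= big_split /= -/(ends _ _) IH // -add1n; congr (_ + _).
case: p pp => // x p _; rewrite ohead_rev (bigD1 (last x p)) //= eqxx big1 // => v /negbTE.
by rewrite (inj_eq Some_inj) eq_sym => ->.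
Qed.

(** * Excess and optimal decompositions *)

Section Consistency.
Variable D : digraph V.

Lemma outc_arcs (q : pred (V * V)) v :
  outc [seq e <- enum (arcs D) | q e] v = #|[set x | D v x && q (v, x)]|.
Proof.
rewrite /outc -size_filter -filter_predI -(size_map snd) cardE.
apply/eqP; rewrite eqn_leq; apply/andP; split; apply: uniq_leq_size.
- rewrite map_inj_in_uniq 1?filter_uniq ?enum_uniq // => -[a1 a2] [b1 b2].
  by rewrite !mem_filter /= => /andP[/andP[/eqP-> _] _] /andP[/andP[/eqP-> _] _] ->.
- move=> x /mapP[[a b] abE ->]; move: abE; rewrite mem_filter !mem_enum !inE /=.
  by case/andP => /andP[/eqP-> ->] ->.
- exact: enum_uniq.
- move=> x; rewrite mem_enum inE => /andP[Dvx qx]; apply/mapP; exists (v, x) => //.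
  by rewrite mem_filter mem_enum !inE /= eqxx qx.
Qed.

Lemma inc_arcs (q : pred (V * V)) v :
  inc [seq e <- enum (arcs D) | q e] v = #|[set x | D x v && q (x, v)]|.
Proof.
rewrite /inc -size_filter -filter_predI -(size_map fst) cardE.
apply/eqP; rewrite eqn_leq; apply/andP; split; apply: uniq_leq_size.
- rewrite map_inj_in_uniq 1?filter_uniq ?enum_uniq // => -[a1 a2] [b1 b2].
  by rewrite !mem_filter /= => /andP[/andP[/eqP-> _] _] /andP[/andP[/eqP-> _] _] ->.
- move=> x /mapP[[a b] abE ->]; move: abE; rewrite mem_filter !mem_enum !inE /=.
  by case/andP => /andP[/eqP-> ->] ->.
- exact: enum_uniq.
- move=> x; rewrite mem_enum inE => /andP[Dvx qx]; apply/mapP; exists (x, v) => //.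
  by rewrite mem_filter mem_enum !inE /= eqxx qx.
Qed.

Lemma outdegE v : outdeg D v = outc (enum (arcs D)) v.
Proof.
rewrite -[enum _](filter_predT) outc_arcs /outdeg /e_out; apply: eq_card => x.
by rewrite !inE andbT.
Qed.

Lemma indegE v : indeg D v = inc (enum (arcs D)) v.
Proof.
rewrite -[enum _](filter_predT) inc_arcs /indeg /e_in; apply: eq_card => x.
by rewrite !inE andbT.
Qed.

Lemma excess_starts P v : perm_eq (arcs_of P) (enum (arcs D)) ->
  excess_at D v = ((starts P v)%:Z - (ends P v)%:Z)%R.
Proof.
move=> pP; rewrite /excess_at outdegE indegE -(outc_perm v pP) -(inc_perm v pP).
by have := arcs_of_degree P v; lia.
Qed.

(** No vertex is both a start and an end, so the absolute excesses add up to exactly [2 * size P];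
    for any other decomposition this sum is at most twice its size. *)
Lemma consistent_decomposition P : all (@proper V) P -> perm_eq (arcs_of P) (enum (arcs D)) ->
  all (from_to (fun v => indeg D v < outdeg D v) (fun v => outdeg D v < indeg D v)) P ->
  consistent D.
Proof.
move=> pP aP sP.
have no_start v : outdeg D v <= indeg D v -> starts P v = 0.
  move=> h; apply/eqP; rewrite -leqn0 leqNgt -has_count; apply/hasPn => t /(allP sP)/andP[st _].
  by apply/negP => /eqP tv; move: st; rewrite tv /= ltnNge h.
have no_end v : indeg D v <= outdeg D v -> ends P v = 0.
  move=> h; apply/eqP; rewrite -leqn0 leqNgt -has_count; apply/hasPn => t /(allP sP)/andP[_ st].
  by apply/negP => /eqP tv; move: st; rewrite tv /= ltnNge h.
have exP : (\sum_v `|excess_at D v| = (2 * size P)%:Z)%R.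
  rewrite mul2n -addnn PoszD -{1}(sum_starts pP) -(sum_ends pP).
  rewrite !(big_morph Posz PoszD (erefl _)) -big_split /=; apply: eq_bigr => v _.
  rewrite (excess_starts v aP); case: (leqP (indeg D v) (outdeg D v)) => h.
    by rewrite (no_end v h) subr0 ger0_norm //; clear; lia.
  by rewrite (no_start v (ltnW h)) sub0r normrN ger0_norm //; clear; lia.
rewrite /consistent /excess exP; suff -> : pn D = size P.
  by rewrite -pmulrn natrM mulrC mulKf.
rewrite /pn; case: ex_minnP => m /asboolP[P' /andP[_ aP'] <-] pmin.
apply/eqP; rewrite eqn_leq pmin /=; last first.
  apply/asboolP; exists P => //; rewrite /path_decomposition aP andbT.
  apply/allP => t tP; have := allP pP _ tP; case: t tP => // x t tP /andP[ut _].
  rewrite /dipath ut andbT path_arcsE; apply/allP => e et.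
  have : e \in enum (arcs D).
    by rewrite -(perm_mem aP); apply/flattenP; exists (path_arcs (x :: t)) => //; apply: map_f.
  by rewrite mem_enum inE.
have : (\sum_v `|excess_at D v| <= (2 * size P')%:Z)%R.
  apply: (@le_trans _ _ (\sum_v ((starts P' v)%:Z + (ends P' v)%:Z))%R).
    apply: ler_sum => v _; rewrite (excess_starts v aP').
    by apply: le_trans (ler_normB _ _) _; rewrite !ger0_norm.
  rewrite big_split /= -!(big_morph Posz PoszD (erefl _)) -PoszD lez_nat mul2n -addnn.
  by rewrite leq_add ?sum_starts_le ?sum_ends_le.
by rewrite exP lez_nat leq_pmul2l.
Qed.

End Consistency.
End Flow.

(** * Absorption *)

Section Reversal.
Variable V : finType.
Implicit Types (p : seq V) (P : seq (seq V)) (v : V).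

Lemma path_arcs_rcons (x y : V) p :
  path_arcs (rcons (x :: p) y) = rcons (path_arcs (x :: p)) (last x p, y).
Proof.
elim: p x => [|z p IH] x //.
by rewrite !rcons_cons path_arcs_cons -rcons_cons IH.
Qed.

Definition swap (e : V * V) := (e.2, e.1).

Lemma path_arcs_rev p : path_arcs (rev p) = rev (map swap (path_arcs p)).
Proof.
elim: p => [|x [|y p] IH] //.
rewrite path_arcs_cons map_cons [RHS]rev_cons -IH !rev_cons -!cats1 -catA /=.
by rewrite path_arcs_cat -cats1.
Qed.

Lemma arcs_of_rev P : perm_eq (arcs_of (map rev P)) (map swap (arcs_of P)).
Proof.
elim: P => [|p P IH] //=; rewrite /arcs_of /= -!/(arcs_of _) map_cat.
by rewrite perm_cat // path_arcs_rev perm_rev perm_refl.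
Qed.

Lemma proper_rev P : all (@proper V) P -> all (@proper V) (map rev P).
Proof. by move/allP => pP; apply/allP => _ /mapP[p /pP pp ->]; rewrite /proper rev_uniq size_rev. Qed.

Lemma starts_rev P v : starts (map rev P) v = ends P v.
Proof. by rewrite /starts count_map. Qed.

Lemma ends_rev P v : ends (map rev P) v = starts P v.
Proof. by rewrite /ends count_map; apply: eq_count => t /=; rewrite revK. Qed.

Lemma balanced_starts P v : balanced (arcs_of P) -> starts P v = ends P v.
Proof. by move=> bP; have := arcs_of_degree P v; rewrite bP => /addnI. Qed.

End Reversal.

Section Absorption.
Variables (V : finType) (D : digraph V) (Ap Am : {set V}) (N M : V -> {set V}).
Variables (h m L R a j k r : nat).

Hypothesis disj : [disjoint Ap & Am].
Hypothesis N_Ap : forall v, v \notin Ap -> N v \subset Ap.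
Hypothesis M_Am : forall v, v \notin Am -> M v \subset Am.
Hypothesis N_arc : forall v x, v \notin Ap -> x \in N v -> D x v.
Hypothesis M_arc : forall v x, v \notin Am -> x \in M v -> D v x.
Hypothesis NM_sym : forall w z, w \in Am -> z \in Ap -> (z \in N w) = (w \in M z).
Hypothesis N_card : forall v, v \notin Ap -> 2 * h + 2 * m <= #|N v|.
Hypothesis M_card : forall v, v \notin Am -> 2 * h + 2 * m <= #|M v|.
Hypothesis NM_card : forall v, v \notin Ap -> v \notin Am -> #|N v| = #|M v|.
Hypothesis N_load : forall x, \sum_(v | v \notin Ap) (x \in N v) <= R.
Hypothesis M_load : forall x, \sum_(v | v \notin Am) (x \in M v) <= R.
Hypothesis R_le : R <= L * m.
Hypothesis Ap_ex : forall v, v \in Ap -> indeg D v + R < outdeg D v.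
Hypothesis Am_ex : forall v, v \in Am -> outdeg D v + R < indeg D v.
Hypothesis h0 : 0 < h.
Hypothesis m0 : 0 < m.
Hypothesis V_r : #|V| * h ^ r < m ^ r.
Hypothesis V_a : #|V| <= a ^ 3.
Hypothesis V_j : #|V| < 2 ^ j.
Hypothesis V_k : #|V| ^ 2 < 2 ^ k.

(** Each of the two repairs multiplies the number of starts per vertex by at most [c], so [s] bounds
    it afterwards. *)
Let c := 1 + walk_cost L r.+1.
Let s := c * (c * (j * (3 * (8 * a * k)))).
Hypothesis s_h : 2 * s <= h.

Let Ap_Am v : v \in Ap -> v \notin Am.
Proof. by move=> vA; rewrite (disjointFr disj). Qed.

Let Am_Ap v : v \in Am -> v \notin Ap.
Proof. by move=> vA; rewrite (disjointFl disj). Qed.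

(** Starts are repaired first on the reversed paths, with [Ap] and [Am] exchanged, which repairs the
    ends, and then on the paths themselves, which keeps good ends good. *)
Lemma repair_both P l : all (@proper V) P -> balanced (arcs_of P) -> (forall v, starts P v <= l) ->
  exists P', [/\ all (@proper V) P', perm_eq (arcs_of P') (arcs_of P),
    forall v, starts P' v <= c * (c * l), all (start_ok Ap N h) P' & all (end_ok Am M h) P'].
Proof.
move=> pP bP sP.
have nb1 v : 2 * h + 2 * m <= #|nb Am M N v|.
  by rewrite /nb; case: ifP => vA; [apply/N_card/Am_Ap | apply/M_card/negbT].
have nb2 v : 2 * h + 2 * m <= #|nb Ap N M v|.
  by rewrite /nb; case: ifP => vA; [apply/M_card/Ap_Am | apply/N_card/negbT].
have ld (A B : {set V}) (N' M' : V -> {set V}) x : [disjoint A & B] ->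
    (forall v, v \notin A -> N' v \subset A) -> (forall v, v \notin B -> M' v \subset B) ->
    (forall x, \sum_(v | v \notin A) (x \in N' v) <= R) ->
    (forall x, \sum_(v | v \notin B) (x \in M' v) <= R) -> \sum_v (x \in nb A N' M' v) <= L * m.
  move=> dAB NA MB lN lM; apply: leq_trans R_le.
  case: (boolP (x \in A)) => xA.
    apply: leq_trans (lN x); rewrite [X in _ <= X]big_mkcond /=; apply: leq_sum => v _.
    rewrite /nb; case: ifP => //= vA; case: (boolP (x \in M' v)) => // /(subsetP (MB v _)).
    by rewrite (disjointFr dAB xA) (disjointFr dAB vA) => /(_ isT).
  apply: leq_trans (lM x); rewrite [X in _ <= X]big_mkcond /=; apply: leq_sum => v _.
  rewrite /nb; case: ifP => [vA|/negbT vA]; first by rewrite (disjointFr dAB vA).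
  case: (boolP (x \in N' v)) => //= /(subsetP (NA v vA)); by rewrite (negbTE xA).
have disj' : [disjoint Am & Ap] by rewrite disjoint_sym.
have sub1 v : v \in Am -> N v \subset Ap by move/Am_Ap/N_Ap.
have sub2 v : v \in Ap -> M v \subset Am by move/Ap_Am/M_Am.
have sym' w z : w \in Ap -> z \in Am -> (z \in M w) = (w \in N z) by move=> wA zA; rewrite NM_sym.
have l1 x := ld Am Ap M N x disj' M_Am N_Ap M_load N_load.
have l2 x := ld Ap Am N M x disj N_Ap M_Am N_load M_load.
have srP v : starts (map rev P) v <= l by rewrite starts_rev -balanced_starts.
have [T [pT aT sT oT _]] := repair_starts disj' M_Am sub1 nb1 sym' l1 m0 V_r (proper_rev pP) srP.
pose Q := map rev T.
have aQ : perm_eq (arcs_of Q) (arcs_of P).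
  apply: perm_trans (arcs_of_rev T) _; apply: perm_trans (perm_map (@swap V) aT) _.
  apply: perm_trans (perm_map (@swap V) (arcs_of_rev P)) _.
  by rewrite -map_comp (eq_map (g := id)) ?map_id // => -[].
have bQ : balanced (arcs_of Q) by apply: balanced_perm bP; rewrite perm_sym.
have sQ v : starts Q v <= c * l by rewrite balanced_starts // ends_rev.
have eQ : all (end_ok Am M h) Q.
  apply/allP => _ /mapP[t tT ->]; have := allP oT _ tT.
  rewrite /end_ok revK; case: t {tT} => // y t /=; case: (y \in Am) => //=.
  have -> // : [set x in y :: t] = [set x in rev (y :: t)].
  by apply/setP => x; rewrite !in_set mem_rev.
have [T' [pT' aT' sT' oT' eT']] := repair_starts disj N_Ap sub2 nb2 NM_sym l2 m0 V_r (proper_rev pT) sQ.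
exists T'; split => //; last exact: eT'.
exact: perm_trans aT' aQ.
Qed.

(** On arcs from [Ap] to [Am] both clauses apply and agree by [NM_sym]. *)
Let reserved (e : V * V) := (e.2 \notin Ap) && (e.1 \in N e.2) || (e.1 \notin Am) && (e.2 \in M e.1).
Let Res := [seq e <- enum (arcs D) | reserved e].

Let Res_out_Am v : v \in Am -> outc Res v = 0.
Proof.
move=> vA; rewrite outc_arcs; apply: eq_card0 => x; rewrite !inE /reserved /= vA /= orbF.
apply/negP => /and3P[_ xA /(subsetP (N_Ap xA))]; by rewrite (negbTE (Am_Ap vA)).
Qed.

Let Res_in_Ap v : v \in Ap -> inc Res v = 0.
Proof.
move=> vA; rewrite inc_arcs; apply: eq_card0 => x; rewrite !inE /reserved /= vA /=.
apply/negP => /and3P[_ xA /(subsetP (M_Am xA))]; by rewrite (negbTE (Ap_Am vA)).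
Qed.

Let Res_out_Ap v : v \in Ap -> outc Res v <= R.
Proof.
move=> vA; rewrite outc_arcs; apply: leq_trans (N_load v).
rewrite -sum1_card big_mkcond [X in _ <= X]big_mkcond /=; apply: leq_sum => x _.
rewrite !inE /reserved /=; case: (D v x) => //=; case: (boolP (x \in Ap)) => xA /=.
  rewrite (Ap_Am vA) /=; case: ifP => // /(subsetP (M_Am (Ap_Am vA))).
  by rewrite (negbTE (Ap_Am xA)).
case: (boolP (v \in N x)) => //= vx; rewrite (Ap_Am vA) /=; case: ifP => // xM.
by move: (xM); rewrite -(NM_sym (subsetP (M_Am (Ap_Am vA)) _ xM) vA) (negbTE vx).
Qed.

Let Res_in_Am v : v \in Am -> inc Res v <= R.
Proof.
move=> vA; rewrite inc_arcs; apply: leq_trans (M_load v).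
rewrite -sum1_card big_mkcond [X in _ <= X]big_mkcond /=; apply: leq_sum => x _.
rewrite !inE /reserved /=; case: (D x v) => //=; rewrite (Am_Ap vA) /=.
case: (boolP (x \in Am)) => xA /=.
  rewrite orbF; case: ifP => // /(subsetP (N_Ap (Am_Ap vA))).
  by rewrite (negbTE (Am_Ap xA)).
case: (boolP (v \in M x)) => //= vx; rewrite ?orbF; case: ifP => // xN.
by move: (xN); rewrite (NM_sym vA (subsetP (N_Ap (Am_Ap vA)) _ xN)) (negbTE vx).
Qed.

Let Res_balanced v : v \notin Ap -> v \notin Am -> outc Res v = inc Res v.
Proof.
move=> vP vM; rewrite outc_arcs inc_arcs.
have -> : [set x | D v x && reserved (v, x)] = M v.
  apply/setP => x; rewrite !inE /reserved /= vM /=.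
  have -> : (x \notin Ap) && (v \in N x) = false.
    by apply/negP => /andP[xA /(subsetP (N_Ap xA))]; rewrite (negbTE vP).
  by case: (boolP (x \in M v)) => [/(M_arc vM)->|]; rewrite ?andbF.
have -> : [set x | D x v && reserved (x, v)] = N v.
  apply/setP => x; rewrite !inE /reserved /= vP /=.
  have -> : (x \notin Am) && (v \in M x) = false.
    by apply/negP => /andP[xA /(subsetP (M_Am xA))]; rewrite (negbTE vM).
  by case: (boolP (x \in N v)) => [/(N_arc vP)->|]; rewrite ?andbF.
by rewrite NM_card.
Qed.


(** * Prolonging the paths by distinct reserved arcs *)

Section Attach.
Variable T : seq (seq V).
Hypothesis pT : all (@proper V) T.
Hypothesis sT : forall v, starts T v <= s.
Hypothesis eT : forall v, ends T v <= s.
Hypothesis start_okT : all (start_ok Ap N h) T.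
Hypothesis end_okT : all (end_ok Am M h) T.

(** An item is one side of a path: [true] is its start, [false] its end. *)
Let I := ('I_(size T) * bool)%type.
Let Q (i : I) := nth [::] T i.1.

Variable x0 : V.
Let hd (i : I) := head x0 (Q i).
Let tl (i : I) := last x0 (Q i).
Let needs (i : I) := if i.2 then hd i \notin Ap else tl i \notin Am.
Let cand (i : I) : {set V * V} :=
  if i.2 then [set (y, hd i) | y in N (hd i) :\: [set y in Q i]]
  else [set (tl i, y) | y in M (tl i) :\: [set y in Q i]].

Let QT i : Q i \in T. Proof. exact: mem_nth. Qed.

Let hdE i : ohead (Q i) = Some (hd i).
Proof. by rewrite /hd; have := allP pT _ (QT i); case: (Q i). Qed.

Let tlE i : ohead (rev (Q i)) = Some (tl i).
Proof. by rewrite /tl; have := allP pT _ (QT i); case: (Q i) => // y p _; rewrite ohead_rev. Qed.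

Let cand_card i : needs i -> h <= #|cand i|.
Proof.
rewrite /needs /cand; case: (i.2) => vA.
  rewrite card_imset => [|y z [->]] //; have := allP start_okT _ (QT i).
  rewrite /start_ok /hd in vA *; move: vA; case: (Q i) (hdE i) => // y p _ /= /negbTE -> //.
rewrite card_imset => [|y z [->]] //; have := allP end_okT _ (QT i).
by rewrite /end_ok tlE (negbTE vA).
Qed.

Let sum_items (F : 'I_(size T) -> bool -> nat) (P : pred I) :
  \sum_(i : I | P i) F i.1 i.2 = \sum_(i < size T) (P (i, true) * F i true + P (i, false) * F i false).
Proof.
rewrite big_mkcond /=; transitivity (\sum_(i : I) if P (i.1, i.2) then F i.1 i.2 else 0).
  by apply: eq_bigr => -[].
rewrite -(pair_bigA _ (fun i b => if P (i, b) then F i b else 0)) /=.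
by apply: eq_bigr => i _; rewrite big_bool; case: (P _); case: (P _); rewrite ?mul1n ?mul0n.
Qed.

Let startsE v : starts T v = \sum_(i < size T) (hd (i, true) == v).
Proof.
rewrite /starts -sum1_count (big_nth [::]) big_mkord big_mkcond /=; apply: eq_bigr => i _.
by rewrite -[nth _ _ _]/(Q (i, true)) hdE (inj_eq Some_inj); case: eqP.
Qed.

Let endsE v : ends T v = \sum_(i < size T) (tl (i, true) == v).
Proof.
rewrite /ends -sum1_count (big_nth [::]) big_mkord big_mkcond /=; apply: eq_bigr => i _.
by rewrite -[nth _ _ _]/(Q (i, true)) tlE (inj_eq Some_inj); case: eqP.
Qed.

(** An assignment of arcs with load one. Each item has at least [h] candidates, and an arc is a
    candidate only for starts at its head and ends at its tail, at most [2 * s <= h] in all. *)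
Lemma attachment : exists f : I -> V * V, (forall i, needs i -> f i \in cand i) /\
  {in needs &, injective f}.
Proof.
have [||f [fc fl]] := @bounded_assignment I _ needs cand (x0, x0) h 1 h0.
- exact: cand_card.
- move=> e; rewrite muln1; apply: leq_trans s_h; rewrite mul2n -addnn.
  apply: (@leq_trans (starts T e.2 + ends T e.1)); last exact: leq_add.
  rewrite (sum_items (fun i b => e \in cand (i, b))) startsE endsE -big_split /=.
  apply: leq_sum => i _; apply: leq_add.
    case: (needs _) => //; rewrite mul1n /cand /=.
    by case: (boolP (e \in _)) => // /imsetP[y _ ->]; rewrite eqxx.
  case: (needs _) => //; rewrite mul1n /cand /=.
  by case: (boolP (e \in _)) => // /imsetP[y _ ->]; rewrite eqxx.
exists f; split=> // i1 i2 n1 n2 fi; apply/eqP/negPn/negP => i12.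
have := fl (f i1); rewrite /load (bigD1 i1) //= (bigD1 i2) /=; last by rewrite eq_sym i12 andbT.
by rewrite fi !eqxx addnA.
Qed.


Lemma extend_paths : exists (W : seq (seq V)) (used : seq (V * V)),
  [/\ all (@proper V) W, perm_eq (arcs_of W) (arcs_of T ++ used), uniq used,
      all (from_to (mem Ap) (mem Am)) W & all (fun e => D e.1 e.2 && reserved e) used] /\
  (forall v, v \notin Ap -> v \notin Am -> outc used v = ends T v /\ inc used v = starts T v).
Proof.
have [f [fc finj]] := attachment.
pose pre i := if needs (i, true) then [:: f (i, true)] else [::].
pose post i := if needs (i, false) then [:: f (i, false)] else [::].
pose ext i := map fst (pre i) ++ Q (i, true) ++ map snd (post i).
pose W := [seq ext i | i <- enum 'I_(size T)].
pose used := [seq f i | i <- enum needs].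
have fE i : needs (i, true) -> exists2 y, f (i, true) = (y, hd (i, true)) &
    y \in N (hd (i, true)) /\ y \notin Q (i, true).
  move=> ni; have := fc _ ni; rewrite /cand /= => /imsetP[y].
  by rewrite inE in_set => /andP[yQ yN] ->; exists y.
have gE i : needs (i, false) -> exists2 y, f (i, false) = (tl (i, true), y) &
    y \in M (tl (i, true)) /\ y \notin Q (i, true).
  move=> ni; have := fc _ ni; rewrite /cand /= => /imsetP[y].
  by rewrite inE in_set => /andP[yQ yN] ->; exists y.
have QE i : Q (i, true) = hd (i, true) :: behead (Q (i, true)).
  by have := hdE (i, true); case: (Q (i, true)) => //= y p [->].
have uQ i : uniq (Q (i, true)) by have /andP[] := allP pT _ (QT (i, true)).
have tlQ i : tl (i, true) = last (hd (i, true)) (behead (Q (i, true))).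
  by rewrite /tl QE.
have extE i : path_arcs (ext i) = pre i ++ path_arcs (Q (i, true)) ++ post i.
  have postE : path_arcs (Q (i, true) ++ map snd (post i)) = path_arcs (Q (i, true)) ++ post i.
    rewrite /post; case: ifP => [/gE[y -> _]|_]; last by rewrite !cats0.
    by rewrite tlQ QE /= cats1 -rcons_cons path_arcs_rcons cats1.
  have consE (y : V) t :
      path_arcs (y :: Q (i, true) ++ t) = (y, hd (i, true)) :: path_arcs (Q (i, true) ++ t).
    by case: (Q (i, true)) (QE i) => // z p [<-]; rewrite !cat_cons path_arcs_cons.
  by rewrite /ext /pre; case: ifP => [/fE[y -> _]|_] /=; rewrite ?consE postE.
have preP i : needs (i, true) -> hd (i, true) \notin Ap by [].
have postP i : needs (i, false) -> tl (i, true) \notin Am by [].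
have preN i : ~~ needs (i, true) -> hd (i, true) \in Ap by move/negbNE.
have postN i : ~~ needs (i, false) -> tl (i, true) \in Am by move/negbNE.
have TE : T = [seq Q (i, true) | i <- enum 'I_(size T)].
  by rewrite -[LHS](mkseq_nth [::]) /mkseq -val_enum_ord -map_comp.
have cused (R' : pred (V * V)) : count R' used = \sum_(i < size T) (count R' (pre i) + count R' (post i)).
  rewrite /used count_map -sum1_count big_enum_cond big_mkcondr /=.
  have -> : \sum_(i in needs) (if R' (f i) then 1 else 0) =
      \sum_(i | needs i) nat_of_bool (R' (f (i.1, i.2))).
    by apply: eq_bigr => -[i b] _ /=; case: (R' _).
  rewrite (sum_items (fun i b => nat_of_bool (R' (f (i, b))))); apply: eq_bigr => i _.
  by rewrite /pre /post; case: (needs _); case: (needs _); rewrite /= ?addn0 ?mul1n ?mul0n.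
have carcs (R' : pred (V * V)) (F : 'I_(size T) -> seq V) :
    count R' (arcs_of [seq F i | i <- enum 'I_(size T)]) = \sum_(i < size T) count R' (path_arcs (F i)).
  by rewrite /arcs_of count_flatten sumnE 3!big_map big_enum.
exists W, used; split; first split.
- apply/allP => _ /mapP[i _ ->]; rewrite /proper; apply/andP; split; last first.
    have /andP[_] := allP pT _ (QT (i, true)); rewrite /ext !size_cat -/(Q _).
    by move=> h1; apply: leq_trans h1 _; rewrite addnCA leq_addr.
  rewrite /ext /pre /post; case: ifP => [ni|_]; case: ifP => [ni'|_] /=; rewrite ?cats0 //.
  + have [y -> [yN yQ]] := fE i ni; have [z -> [zM zQ]] := gE i ni' => /=.
    rewrite cats1 mem_rcons inE negb_or yQ rcons_uniq zQ uQ !andbT.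
    have yA := subsetP (N_Ap (preP i ni)) _ yN; have zA := subsetP (M_Am (postP i ni')) _ zM.
    (* The two added vertices differ, as one is in [Ap] and the other in [Am]. *)
    by apply: contraTneq zA => <-; apply: Ap_Am.
  + by have [y -> [yN yQ]] := fE i ni; rewrite /= yQ uQ.
  + by have [z -> [zM zQ]] := gE i ni'; rewrite /= cats1 rcons_uniq zQ uQ.
- apply/permP => R'; rewrite count_cat [X in _ = count _ (arcs_of X) + _]TE !carcs.
  rewrite cused -big_split /=; apply: eq_bigr => i _.
  by rewrite extE !count_cat addnCA.
- by rewrite map_inj_in_uniq ?enum_uniq // => x y; rewrite !mem_enum; apply: finj.
- apply/allP => _ /mapP[i _ ->]; rewrite /from_to /ext; apply/andP; split.
    rewrite /pre; case: ifP => [ni|/negbT/preN hA]; last by rewrite QE /=.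
    by have [y -> [yN _]] := fE i ni; rewrite /= (subsetP (N_Ap (preP i ni)) _ yN).
  rewrite catA rev_cat /post; case: ifP => [ni|/negbT/postN hA].
    by have [y -> [yN _]] := gE i ni; rewrite /= (subsetP (M_Am (postP i ni)) _ yN).
  by rewrite /= rev_cat QE lastI rev_rcons /= -tlQ.
- apply/allP => _ /mapP[[i b] ib ->]; rewrite mem_enum in ib; case: b ib => ib.
    have [y -> [yN _]] := fE i ib; rewrite /reserved /= yN (preP i ib) /= andbT.
    by apply: N_arc => //; apply: preP.
  have [y -> [yM _]] := gE i ib; rewrite /reserved /= yM (postP i ib) /= orbT andbT.
  by apply: M_arc => //; apply: postP.
move=> v vP vM; rewrite /outc /inc !cused startsE endsE; split; apply: eq_bigr => i _.
  have -> : count (fun e => e.1 == v) (pre i) = 0.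
    rewrite /pre; case: ifP => // ni; have [y -> [yN _]] := fE i ni; rewrite /= addn0.
    by case: eqP => // yv; move: vP; rewrite -yv (subsetP (N_Ap (preP i ni)) _ yN).
  rewrite /post; case: ifP => [ni|/negbT/postN hA].
    by have [y -> _] := gE i ni; rewrite /= addn0.
  by case: eqP => // tv; rewrite tv (negbTE vM) in hA.
have -> : count (fun e => e.2 == v) (post i) = 0.
  rewrite /post; case: ifP => // ni; have [y -> [yN _]] := gE i ni; rewrite /= addn0.
  by case: eqP => // yv; move: vM; rewrite -yv (subsetP (M_Am (postP i ni)) _ yN).
rewrite /pre; case: ifP => [ni|/negbT/preN hA].
  by have [y -> _] := fE i ni; rewrite /= !addn0.
by case: eqP => // tv; rewrite tv (negbTE vP) in hA.
Qed.

End Attach.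


Lemma absorption : consistent D.
Proof.
have uD : uniq (enum (arcs D)) := enum_uniq _.
pose D' := [seq e <- enum (arcs D) | ~~ reserved e].
have pD : perm_eq (Res ++ D') (enum (arcs D)) by rewrite perm_filterC.
have degO v : outdeg D v = outc Res v + outc D' v by rewrite outdegE -(outc_perm v pD) outc_cat.
have degI v : indeg D v = inc Res v + inc D' v by rewrite indegE -(inc_perm v pD) inc_cat.
have uD' : uniq D' by apply: filter_uniq.
have [P1 [E [pP1 aP1 bE sP1]]] := flow_decomposition uD'.
have ED : {subset E <= enum (arcs D)}.
  by move=> e eE; rewrite -(perm_mem pD) mem_cat -(perm_mem aP1) mem_cat eE !orbT.
have uE : uniq E by move: uD'; rewrite -(perm_uniq aP1) cat_uniq => /and3P[].
have lE : loopless E.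
  apply/allP => -[u v] /ED; rewrite mem_enum inE /=; case: eqP => // -> .
  by rewrite arc_irrefl.
have sE : size E < 2 ^ k.
  apply: leq_ltn_trans V_k; rewrite -mulnn -card_prod cardE; apply: uniq_leq_size => // e _.
  by rewrite mem_enum.
have setE : arcs_in E [set: V] by apply/allP => e _; rewrite !inE.
have sj : #|[set: V]| < 2 ^ j by rewrite cardsT.
have sa : #|[set: V]| <= a ^ 3 by rewrite cardsT.
have [P2 [pP2 aP2 sP2]] := loaded_decomposition uE lE bE setE sa sj sE.
have bP2 : balanced (arcs_of P2) by apply: balanced_perm bE; rewrite perm_sym.
have [T [pT aT sT oT eT]] := repair_both pP2 bP2 sP2.
have bT : balanced (arcs_of T) by apply: balanced_perm bP2; rewrite perm_sym.
have eT' v : ends T v <= s by rewrite -balanced_starts.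
case: (set_0Vmem [set: V]) => [V0|[x0 _]].
  apply: (@consistent_decomposition _ D [::]) => //.
  by case: (enum (arcs D)) => // -[v w] t; have := in_setT v; rewrite V0 inE.
have [W [used [[pW aW uused sW usedP] usedE]]] := extend_paths pT sT eT' oT eT x0.
have usedR : {subset used <= Res}.
  by move=> e /(allP usedP)/andP[De re]; rewrite mem_filter re mem_enum inE.
have uRes : uniq Res := filter_uniq _ uD.
set Un := [seq e <- Res | e \notin used].
have pUn : perm_eq (used ++ Un) Res := perm_diff uRes uused usedR.
have UnO v : outc Res v = outc used v + outc Un v by rewrite -(outc_perm v pUn) outc_cat.
have UnI v : inc Res v = inc used v + inc Un v by rewrite -(inc_perm v pUn) inc_cat.
have uUn : uniq Un by apply: filter_uniq.
have UnB v : v \notin Ap -> v \notin Am -> outc Un v = inc Un v.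
  move=> vP vM; have [uo ui] := usedE v vP vM; have := Res_balanced vP vM.
  by rewrite UnO UnI uo ui balanced_starts // => /addnI.
have UnOm v : v \in Am -> outc Un v = 0 by move/Res_out_Am/eqP; rewrite UnO addn_eq0 => /andP[_ /eqP].
have UnIp v : v \in Ap -> inc Un v = 0 by move/Res_in_Ap/eqP; rewrite UnI addn_eq0 => /andP[_ /eqP].
have [P3 [B3 [pP3 aP3 bB3 sP3]]] := flow_decomposition uUn.
have B30 : B3 = [::].
  case EB : B3 => [//|e B3']; have eB : e \in B3 by rewrite EB mem_head.
  have leO v : outc B3 v <= outc Un v by rewrite -(outc_perm v aP3) outc_cat leq_addl.
  have leI v : inc B3 v <= inc Un v by rewrite -(inc_perm v aP3) inc_cat leq_addl.
  have O1 : 0 < outc B3 e.1 by rewrite -has_count; apply/hasP; exists e => /=.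
  have I1 : 0 < inc B3 e.2 by rewrite -has_count; apply/hasP; exists e => /=.
  have : e \in Res by rewrite -(perm_mem pUn) mem_cat -(perm_mem aP3) mem_cat eB !orbT.
  rewrite mem_filter => /andP[+ _].
  rewrite bB3 in O1; rewrite -bB3 in I1.
  case/orP => /andP[e2 e1]; suff: false by [].
    have /UnIp z := subsetP (N_Ap e2) _ e1.
    by have := leq_trans O1 (leI _); rewrite z.
  have /UnOm z := subsetP (M_Am e2) _ e1.
  by have := leq_trans I1 (leO _); rewrite z.
apply: (@consistent_decomposition _ D (P1 ++ W ++ P3)).
- by rewrite !all_cat pP1 pW.
- apply: perm_trans pD; apply/permP => R'; rewrite !arcs_of_cat !count_cat.
  rewrite (permP aW) -(permP aP1) -(permP pUn) !count_cat -(permP aP3) B30 !count_cat.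
  rewrite (permP aT) (permP aP2) /=.
  move: (count R' (arcs_of P1)) (count R' E) (count R' used) (count R' (arcs_of P3)).
  by clear; lia.
have signP v : v \in Ap -> indeg D v < outdeg D v.
  by move/Ap_ex; apply: leq_ltn_trans; apply: leq_addr.
have signM v : v \in Am -> outdeg D v < indeg D v.
  by move/Am_ex; apply: leq_ltn_trans; apply: leq_addr.
rewrite !all_cat; apply/and3P; split.
(* Deleting the reserved arcs preserves the signs of excesses: at most [R] arcs are lost at a vertex
   of [Ap] or [Am], and equally many in and out elsewhere. *)
- apply: sub_all sP1 => t; apply: from_to_sub => x lt.
    case: (boolP (x \in Ap)) => [/signP//|xP].
    case: (boolP (x \in Am)) => xM; last by rewrite degO degI Res_balanced // ltn_add2l.
    have := Am_ex xM; rewrite degO degI Res_out_Am // add0n => h1.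
    have h2 := Res_in_Am xM; move: h1 h2 lt; clear; lia.
  case: (boolP (x \in Am)) => [/signM//|xM].
  case: (boolP (x \in Ap)) => xP; last by rewrite degO degI Res_balanced // ltn_add2l.
  have := Ap_ex xP; rewrite degO degI Res_in_Ap // add0n => h1.
  have h2 := Res_out_Ap xP; move: h1 h2 lt; clear; lia.
- by apply: sub_all sW => t; apply: from_to_sub => x; [apply: signP | apply: signM].
apply: sub_all sP3 => t; apply: from_to_sub => x lt.
  case: (boolP (x \in Ap)) => [/signP//|xP].
  case: (boolP (x \in Am)) => xM; first by rewrite UnOm in lt.
  by rewrite UnB ?ltnn in lt.
case: (boolP (x \in Am)) => [/signM//|xM].
case: (boolP (x \in Ap)) => xP; first by rewrite UnIp in lt.
by rewrite UnB ?ltnn in lt.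
Qed.

End Absorption.

(** * The choice of the reserved arcs and of the parameters *)

(* The candidates of [v] are cut into [K] disjoint blocks of size [g], one for
   each choice to be made. *)
Lemma select_neighbours (V : finType) (A : {set V}) (nbr : V -> {set V}) (K g q : nat) :
  0 < g -> {in A, forall v, K * g <= #|nbr v|} ->
  (forall x, \sum_(v in A) (x \in nbr v) <= g * q) ->
  exists N : V -> {set V}, {in A, forall v, N v \subset nbr v /\ #|N v| = K} /\
    (forall x, \sum_(v in A) (x \in N v) <= q).
Proof.
move=> g0 big ld; case: (set_0Vmem A) => [A0|[x0 _]].
  exists (fun _ => set0); split=> [v|x]; first by rewrite A0 inE.
  by rewrite big1 // => v _; rewrite inE.
pose I := (V * 'I_K)%type; pose P (i : I) := i.1 \in A.
pose block (i : I) := take g (drop (i.2 * g) (enum (nbr i.1))).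
have mem_block i x : x \in block i -> x \in nbr i.1 /\ index x (enum (nbr i.1)) %/ g = i.2.
  move=> xb; have xE := mem_drop (mem_take xb); rewrite mem_enum in xE; split=> //.
  have lo := mem_drop_index (enum_uniq _) (mem_take xb).
  have hi : index x (enum (nbr i.1)) < i.2.+1 * g.
    rewrite mulSn -(in_take _ (mem_drop (mem_take xb))); move: xb.
    by rewrite /block take_drop => /mem_drop.
  by apply/eqP; rewrite eqn_leq -ltnS ltn_divLR // hi leq_divRL.
have pairE (F : I -> nat) : \sum_(i | P i) F i = \sum_(v in A) \sum_(i < K) F (v, i).
  by rewrite pair_big /=; apply: eq_big => -[v i] //=; rewrite andbT.
pose cand (i : I) : {set V} := [set x in block i].
have [||f [fc fl]] := @bounded_assignment I V P cand x0 g q g0.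
- move=> [v i] vA; rewrite /cand cardsE.
  have ub : uniq (block (v, i)) by rewrite take_uniq ?drop_uniq ?enum_uniq.
  rewrite (card_uniqP ub) size_takel // size_drop -cardE /=.
  have := big v vA; have := ltn_ord i; clear -g0; nia.
- move=> x; apply: leq_trans (ld x).
  rewrite pairE; apply: leq_sum => v vA.
  case: (boolP [exists i : 'I_K, x \in block (v, i)]) => [/existsP[i0 xi]|/existsPn no].
    have [xv ix] := mem_block _ _ xi; rewrite xv (bigD1 i0) //= big1 ?addn0 ?leq_b1 // => i ii0.
    rewrite inE; apply/eqP; rewrite eqb0; apply: contra ii0 => /mem_block[_ /= ix'].
    by apply/eqP/val_inj; rewrite /= -ix' -ix.
  by rewrite big1 // => i _; rewrite inE (negbTE (no i)).
exists (fun v => [set f (v, i) | i : 'I_K]); split=> [v vA|x].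
  have fb i : f (v, i) \in block (v, i) by have := fc (v, i) vA; rewrite inE.
  split; first by apply/subsetP => _ /imsetP[i _ ->]; have [] := mem_block _ _ (fb i).
  rewrite card_imset ?card_ord // => i1 i2 E; apply: val_inj => /=.
  by have [_ /= <-] := mem_block _ _ (fb i1); have [_ /= <-] := mem_block _ _ (fb i2); rewrite E.
apply: leq_trans (fl x); rewrite /load.
rewrite pairE; apply: leq_sum => v vA; case: (boolP (x \in _)) => // /imsetP[i _ ->].
by rewrite (bigD1 i) //= eqxx.
Qed.

(** * Reserving arcs for every vertex *)

Section Reservation.
Variables (V : finType) (D : digraph V) (Ap Am : {set V}) (d K : nat).
Let A0 := ~: (Ap :|: Am).
Hypothesis K0 : 0 < K.
Hypothesis Kd : 25 * K <= d.
Hypothesis Ap_out : forall v, v \in Ap -> d <= 4 * e_out D v Am /\ e_out D v Am <= d.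
Hypothesis Am_in : forall v, v \in Am -> d <= 4 * e_in D Ap v /\ e_in D Ap v <= d.
Hypothesis Ap_A0 : forall v, v \in Ap -> 3 * e_out D v A0 <= d.
Hypothesis Am_A0 : forall v, v \in Am -> 3 * e_in D A0 v <= d.
Hypothesis A0_deg : forall v, v \in A0 -> d <= 3 * e_in D Ap v /\ d <= 3 * e_out D v Am.

Let sum_out x (S : {set V}) : \sum_(v in S) (D x v : nat) = e_out D x S.
Proof. by rewrite /e_out -sum1_card -big_mkcondr /=; apply: eq_bigl => v; rewrite inE. Qed.

Let sum_in x (S : {set V}) : \sum_(v in S) (D v x : nat) = e_in D S x.
Proof. by rewrite /e_in -sum1_card -big_mkcondr /=; apply: eq_bigl => v; rewrite inE. Qed.

Lemma reservation : exists N M : V -> {set V},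
  [/\ forall v, v \notin Ap -> N v \subset Ap, forall v, v \notin Am -> M v \subset Am,
      forall v x, v \notin Ap -> x \in N v -> D x v & forall v x, v \notin Am -> x \in M v -> D v x] /\
  [/\ forall w z, w \in Am -> z \in Ap -> (z \in N w) = (w \in M z),
      forall v, v \notin Ap -> K <= #|N v|, forall v, v \notin Am -> K <= #|M v|,
      forall v, v \notin Ap -> v \notin Am -> #|N v| = #|M v| &
      (forall x, \sum_(v | v \notin Ap) (x \in N v) <= 8 * K) /\
      (forall x, \sum_(v | v \notin Am) (x \in M v) <= 8 * K)].
Proof.
pose nin v := [set z in Ap | D z v]; pose nout v := [set w in Am | D v w].
(* Block sizes such that [K] blocks fit into [d / 4] and [d / 3] candidates. As [25 * K <= d],
   rounding costs little and the loads are at most [5 * K] and [2 * K]. *)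
pose g := d %/ (4 * K); pose g' := d %/ (3 * K).
have g0 : 0 < g by rewrite divn_gt0 ?muln_gt0 //; move: Kd; clear; lia.
have g0' : 0 < g' by rewrite divn_gt0 ?muln_gt0 //; move: Kd; clear; lia.
have gK : 4 * (K * g) <= d by have := leq_trunc_div d (4 * K); rewrite -/g; clear; lia.
have gK' : 3 * (K * g') <= d by have := leq_trunc_div d (3 * K); rewrite -/g'; clear; lia.
have gd : d <= g * (5 * K).
  have := ltn_ceil d (_ : 0 < 4 * K); rewrite muln_gt0 K0 -/g => /(_ isT); move: Kd K0; clear; nia.
have gd' : d <= 3 * (g' * (2 * K)).
  have := ltn_ceil d (_ : 0 < 3 * K); rewrite muln_gt0 K0 -/g' => /(_ isT); move: Kd K0 g0'; clear; nia.
have [||N1 [N1s N1l]] := @select_neighbours V Am nin K g (5 * K) g0.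
- move=> v /Am_in[h _]; rewrite -(@leq_pmul2l 4) //; exact: leq_trans gK h.
- move=> x; case: (boolP (x \in Ap)) => xA; last by rewrite big1 // => v _; rewrite inE (negbTE xA).
  apply: leq_trans gd; have [_] := Ap_out xA; rewrite -sum_out; apply: leq_trans.
  by apply: leq_sum => v _; rewrite inE xA.
have [||N2 [N2s N2l]] := @select_neighbours V Ap nout K g (5 * K) g0.
- move=> v /Ap_out[h _]; rewrite -(@leq_pmul2l 4) //; exact: leq_trans gK h.
- move=> x; case: (boolP (x \in Am)) => xA; last by rewrite big1 // => v _; rewrite inE (negbTE xA).
  apply: leq_trans gd; have [_] := Am_in xA; rewrite -sum_in; apply: leq_trans.
  by apply: leq_sum => v _; rewrite inE xA.
have [||N3 [N3s N3l]] := @select_neighbours V A0 nin K g' (2 * K) g0'.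
- move=> v /A0_deg[h _]; rewrite -(@leq_pmul2l 3) //; exact: leq_trans gK' h.
- move=> x; case: (boolP (x \in Ap)) => xA; last by rewrite big1 // => v _; rewrite inE (negbTE xA).
  rewrite -(@leq_pmul2l 3) //; apply: leq_trans gd'; apply: leq_trans (Ap_A0 xA); rewrite -sum_out leq_mul //.
  by apply: leq_sum => v _; rewrite inE xA.
have [||N4 [N4s N4l]] := @select_neighbours V A0 nout K g' (2 * K) g0'.
- move=> v /A0_deg[_ h]; rewrite -(@leq_pmul2l 3) //; exact: leq_trans gK' h.
- move=> x; case: (boolP (x \in Am)) => xA; last by rewrite big1 // => v _; rewrite inE (negbTE xA).
  rewrite -(@leq_pmul2l 3) //; apply: leq_trans gd'; apply: leq_trans (Am_A0 xA); rewrite -sum_in leq_mul //.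
  by apply: leq_sum => v _; rewrite inE xA.
(* An arc between [Ap] and [Am] is reserved if either end selected it; this gives the symmetry of
   [N] and [M]. *)
pose N v := if v \in Am then N1 v :|: [set z in Ap | v \in N2 z] else N3 v.
pose M v := if v \in Ap then N2 v :|: [set w in Am | v \in N1 w] else N4 v.
have inA0 v : v \notin Ap -> v \notin Am -> v \in A0 by move=> vP vM; rewrite !inE negb_or vP.
have Nsub v : v \notin Ap -> N v \subset nin v.
  move=> vP; rewrite /N; case: (boolP (v \in Am)) => vM; last by have [] := N3s v (inA0 v vP vM).
  rewrite subUset; have [-> _] := N1s v vM; apply/subsetP => z; rewrite !inE => /andP[zP vz].
  by have [/subsetP/(_ v vz)] := N2s z zP; rewrite inE zP => /andP[_ ->].
have Msub v : v \notin Am -> M v \subset nout v.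
  move=> vM; rewrite /M; case: (boolP (v \in Ap)) => vP; last by have [] := N4s v (inA0 v vP vM).
  rewrite subUset; have [-> _] := N2s v vP; apply/subsetP => z; rewrite !inE => /andP[zM vz].
  by have [/subsetP/(_ v vz)] := N1s z zM; rewrite inE zM => /andP[_ ->].
exists N, M; split; first split.
- by move=> v /Nsub h; apply: subset_trans h _; apply/subsetP => z; rewrite inE => /andP[].
- by move=> v /Msub h; apply: subset_trans h _; apply/subsetP => z; rewrite inE => /andP[].
- by move=> v x /Nsub/subsetP h /h; rewrite inE => /andP[].
- by move=> v x /Msub/subsetP h /h; rewrite inE => /andP[].
split.
- by move=> w z wM zP; rewrite /N /M wM zP !inE wM zP /= orbC.
- move=> v vP; rewrite /N; case: (boolP (v \in Am)) => vM; last by have [_ ->] := N3s v (inA0 v vP vM).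
  have [_ <-] := N1s v vM; exact/subset_leq_card/subsetUl.
- move=> v vM; rewrite /M; case: (boolP (v \in Ap)) => vP; last by have [_ ->] := N4s v (inA0 v vP vM).
  have [_ <-] := N2s v vP; exact/subset_leq_card/subsetUl.
- move=> v vP vM; rewrite /N /M (negbTE vP) (negbTE vM).
  by have [_ ->] := N3s v (inA0 v vP vM); have [_ ->] := N4s v (inA0 v vP vM).
split=> x.
  case: (boolP (x \in Ap)) => xA; last first.
    rewrite big1 // => v /Nsub/subsetP h; apply/eqP; rewrite eqb0.
    by apply: contra xA => /h; rewrite inE => /andP[].
  rewrite (bigID (mem Am)) /=.
  (* At [x]: selections by [Am], its own selection, and selections by vertices outside both sets. *)
  apply: (@leq_trans ((5 * K + K) + 2 * K)); last by clear; lia.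
  apply: leq_add; last first.
    apply: leq_trans (N3l x); rewrite [X in _ <= X](eq_bigl (fun v => (v \notin Ap) && (v \notin Am))).
      by apply: leq_sum => v /andP[_ vM]; rewrite /N (negbTE vM).
    by move=> v; rewrite !inE negb_or.
  apply: (@leq_trans (\sum_(v in Am) ((x \in N1 v) + (v \in N2 x)))).
    rewrite big_mkcond [X in _ <= X]big_mkcond /=; apply: leq_sum => v _.
    case: (boolP (v \in Am)) => vM; rewrite ?andbF //= andbT; case: ifP => // _.
    by rewrite /N vM !inE xA /=; case: (x \in N1 v); case: (v \in N2 x).
  rewrite big_split leq_add // ; have [_ <-] := N2s x xA.
  rewrite -sum1_card big_mkcond [X in _ <= X]big_mkcond; apply: leq_sum => v _ /=.
  by case: (v \in Am); case: (v \in N2 x).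
case: (boolP (x \in Am)) => xA; last first.
  rewrite big1 // => v /Msub/subsetP h; apply/eqP; rewrite eqb0.
    by apply: contra xA => /h; rewrite inE => /andP[].
rewrite (bigID (mem Ap)) /=.
apply: (@leq_trans ((5 * K + K) + 2 * K)); last by clear; lia.
apply: leq_add; last first.
  apply: leq_trans (N4l x); rewrite [X in _ <= X](eq_bigl (fun v => (v \notin Am) && (v \notin Ap))).
    by apply: leq_sum => v /andP[_ vM]; rewrite /M (negbTE vM).
  by move=> v; rewrite !inE negb_or andbC.
apply: (@leq_trans (\sum_(v in Ap) ((x \in N2 v) + (v \in N1 x)))).
  rewrite big_mkcond [X in _ <= X]big_mkcond /=; apply: leq_sum => v _.
  case: (boolP (v \in Ap)) => vM; rewrite ?andbF //= andbT; case: ifP => // _.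
  by rewrite /M vM !inE xA /=; case: (x \in N2 v); case: (v \in N1 x).
rewrite big_split leq_add // ; have [_ <-] := N1s x xA.
rewrite -sum1_card big_mkcond [X in _ <= X]big_mkcond; apply: leq_sum => v _ /=.
by case: (v \in Ap); case: (v \in N1 x).
Qed.

End Reservation.

(** Here [n] is about [x ^ 60], [a] bounds its cube root, and [j], [k], linear in [x], generously
    bound logarithms. The load is then exactly [h = C * x ^ 22], so far below [x ^ 24] that the 61st
    power of the ratio outweighs [n]. *)
Lemma parameter_choice c : 0 < c -> exists x0, forall x n, x0 <= x -> x ^ 60 <= n -> n < x.+1 ^ 60 ->
  exists h a j k, [/\ 0 < h, h <= x ^ 24, n * h ^ 61 < (x ^ 24) ^ 61, n <= a ^ 3 & n < 2 ^ j] /\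
    (n ^ 2 < 2 ^ k /\ 2 * (c * (c * (j * (3 * (8 * a * k))))) <= h).
Proof.
move=> c0; have [J EJ] : exists J, J = 120 by exists 120.
have [e Ee] : exists e, e = 2 ^ 20 by exists (2 ^ 20).
have [C EC] : exists C, C = 2 * (c * (c * (J * (3 * (8 * e * (2 * J)))))) by eexists.
have J0 : 0 < J by rewrite EJ.
have e0 : 0 < e by rewrite Ee expn_gt0.
have C0 : 0 < C by rewrite EC !muln_gt0 c0 J0 e0.
exists (2 * C) => x n xC nl nu.
have x0 : 0 < x by move: C0 xC; clear; lia.
have n2 : n < (2 * x) ^ 60.
  by apply: leq_trans nu _; rewrite leq_exp2r //; move: x0; clear; lia.
have nj : n < 2 ^ (J * x).
  apply: leq_trans n2 _; have -> : J * x = 2 * x * 60 by rewrite EJ; clear; lia.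
  rewrite expnM leq_exp2r //.
  exact/ltnW/ltn_expl.
exists (C * x ^ 22), ((2 * x) ^ 20), (J * x), (2 * J * x); split; split.
- by rewrite muln_gt0 C0 expn_gt0 x0.
- rewrite (expnD x 2 22) leq_mul // expnS expn1; move: xC x0; clear; nia.
- have: 0 < x ^ 22 by rewrite expn_gt0 x0.
  rewrite (expnD x 22 2); move: (x ^ 22) => y y0.
  rewrite (expnMn C) (expnMn y) mulnA mulnC ltn_pmul2l; last by rewrite expn_gt0 y0.
  have -> : (x ^ 2) ^ 61 = x ^ 61 * x ^ 61 by rewrite -mulnn expnMn.
  apply: (@leq_trans ((2 * x) ^ 60 * C ^ 61)); first by rewrite ltn_pmul2r ?expn_gt0 ?C0.
  apply: (@leq_trans (x ^ 60 * (2 * C) ^ 61)).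
    rewrite !expnMn (expnSr 2 60); move: (2 ^ 60) (x ^ 60) (C ^ 61); clear => u v w; nia.
  have h61 : (2 * C) ^ 61 <= x ^ 61 by rewrite leq_exp2r.
  exact: leq_mul (leq_pexp2l x0 (leqnSn 60)) h61.
- by apply: leq_trans (ltnW n2) _; rewrite (expnM _ 20 3).
- exact: nj.
- by rewrite -mulnA mulnC expnM ltn_exp2r.
rewrite EC expnMn -Ee; apply: eq_leq.
have -> : x ^ 22 = x ^ 20 * (x * x) by rewrite (expnD x 20 2).
by move: (x ^ 20); clear => y; lia.
Qed.

(** * The real threshold and the conclusion *)

Local Open Scope ring_scope.

Lemma one_le_ln (R : realType) (n : nat) : (4 <= n)%N -> 1 <= ln (n%:R : R).
Proof.
move=> n4; have ln2 : (1 / 2 : R) <= ln 2.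
  have := @le_ln1Dx R (- (1 / 2)); have -> : 1 + - (1 / 2) = 2^-1 :> R by field.
  by rewrite lnV ?posrE //; lra.
have l4 : ln (4 : R) = 2 * ln 2.
  have -> : (4 : R) = 2 ^+ 2 by rewrite -natrX.
  by rewrite lnXn // mulr_natl.
apply: (@le_trans _ _ (ln 4)); first by rewrite l4; lra.
by rewrite ler_ln ?posrE ?ler_nat // ltr0n; apply: leq_trans n4.
Qed.

(** [60 * (2 / 5) = 24], and the logarithm is at least 1. *)
Lemma threshold_lower (R : realType) (x n : nat) : (4 <= x)%N -> (x ^ 60 <= n)%N ->
  (x ^ 24)%:R <= (n%:R * ln n%:R) `^ (2 / 5) :> R.
Proof.
move=> x4 xn.
have n4 : (4 <= n)%N.
  apply: leq_trans (x4) _; apply: leq_trans xn.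
  by rewrite -{1}[x]expn1 leq_pexp2l // (leq_trans _ x4).
have -> : (x ^ 24)%:R = (x ^ 60)%:R `^ (2 / 5) :> R.
  rewrite !natrX -(powR_mulrn 24) ?ler0n // -(powR_mulrn 60) ?ler0n // -powRrM.
  by congr (_ `^ _); field.
have ln1 := one_le_ln R n4.
have r0 : (0 : R) <= 2 / 5 by lra.
have px : ((x ^ 60)%:R : R) \is Num.nneg by rewrite nnegrE ler0n.
have pn : (n%:R * ln n%:R : R) \is Num.nneg.
  by rewrite nnegrE mulr_ge0 ?ler0n // (le_trans _ ln1).
apply: (ge0_ler_powR r0 px pn); apply: (@le_trans _ _ n%:R); first by rewrite ler_nat.
by rewrite ler_peMr ?ler0n.
Qed.

Theorem theorem1p3 (R : realType) :
  exists (n0 : nat) (c : R), 0 < c /\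
    forall (V : finType) (D : digraph V), (n0 <= #|V|)%N ->
    let t : R := c * ((#|V|%:R * ln #|V|%:R) `^ (2 / 5)) in
    let Ap := Aplus D t in
    let Am := Aminus D t in
    let A0 := Azero D t in
    (exists d : R, t <= d /\
      [/\ forall v, v \in Ap ->
            d / 4 <= (e_out D v Am)%:R /\ (e_out D v Am)%:R <= d,
          forall v, v \in Am ->
            d / 4 <= (e_in D Ap v)%:R /\ (e_in D Ap v)%:R <= d,
          forall v, v \in Ap :|: Am ->
            (e_out D v A0)%:R <= Num.min (d / 3) (t ^+ 2 / 10 ^+ 6) /\
            (e_in D A0 v)%:R <= Num.min (d / 3) (t ^+ 2 / 10 ^+ 6)
        & forall v, v \in A0 ->
            d / 3 <= (e_in D Ap v)%:R /\ d / 3 <= (e_out D v Am)%:R]) ->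
    consistent D.

Proof.
(* Reserving [4 * m] arcs per vertex, with [m = x ^ 24], gives loads [8 * (4 * m) = 32 * m], hence
   [L = 32]. *)
have [x0 x0P] := @parameter_choice (1 + walk_cost 32 61.+1)%N isT.
(* The factor 100 is the 25 of the reservation times 4; it also makes the excesses in [Ap] and [Am]
   exceed the load [32 * m]. *)
exists ((x0 + 4) ^ 60)%N, 100; split=> // V D nV t Ap Am A0 [d [td [h1 h2 h3 h4]]].
have [x [xn nx]] : exists x, (x ^ 60 <= #|V|)%N /\ (#|V| < x.+1 ^ 60)%N.
  have bnd x : (x ^ 60 <= #|V|)%N -> (x <= #|V|)%N.
    by apply: leq_trans; rewrite -{1}[x]expn1; case: x => // x; apply: leq_pexp2l.
  have ex : exists x, (x ^ 60 <= #|V|)%N by exists 0%N; rewrite exp0n.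
  case: (ex_maxnP ex bnd) => x xV xmax; exists x; split=> //.
  by rewrite ltnNge; apply/negP => /xmax; rewrite ltnn.
have xx0 : (x0 + 4 <= x)%N.
  by rewrite -ltnS -(@ltn_exp2r _ _ 60) //; apply: leq_ltn_trans nV nx.
have x4 : (4 <= x)%N by apply: leq_trans xx0; apply: leq_addl.
have [h [a [j [k [[h0 hm Vr Va Vj] [Vk sh]]]]]] := x0P x #|V| (leq_trans (leq_addr _ _) xx0) xn nx.
have tx : (100 * x ^ 24)%:R <= t.
  by rewrite natrM /t ler_wpM2l //; apply: threshold_lower.
move: (x ^ 24)%N tx hm Vr sh => m tx hm Vr sh.
have m0 : (0 < m)%N by apply: leq_trans hm.
have t0 : 0 < t by apply: lt_le_trans tx; rewrite ltr0n muln_gt0.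
have ApE v : v \in Ap -> (indeg D v + 100 * m <= outdeg D v)%N.
  rewrite inE => tv; have := le_trans tx tv.
  by rewrite /excess_at pmulrn ler_int; clear; lia.
have AmE v : v \in Am -> (outdeg D v + 100 * m <= indeg D v)%N.
  rewrite inE => tv; have := le_trans tx (_ : t <= (- excess_at D v)%:~R).
  by rewrite mulrNz lerNr => /(_ tv); rewrite /excess_at pmulrn -mulrNz ler_int; clear; lia.
have disj : [disjoint Ap & Am].
  rewrite disjoint_subset; apply/subsetP => v /ApE vp; rewrite inE; apply/negP => /AmE vm.
  by move: vp vm m0; clear; lia.
(* Degrees are integers, so upper bounds by [d] survive truncation, and lower bounds only weaken. *)
pose dn := Num.Def.trunc d.
have d0 : 0 <= d by apply: le_trans td; apply: ltW.
have dnd : dn%:R <= d by rewrite Num.Theory.truncn_le.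
have le_dn (e : nat) : e%:R <= d -> (e <= dn)%N by rewrite Num.Theory.truncn_ge_nat.
have dn_le (e q : nat) : (0 < q)%N -> d / q%:R <= e%:R -> (dn <= q * e)%N.
  move=> q0; rewrite ler_pdivrMr ?ltr0n // -natrM mulnC => de.
  by rewrite -(ler_nat R); apply: le_trans dnd de.
have le_dn3 (e : nat) : e%:R <= Num.min (d / 3) (t ^+ 2 / 10 ^+ 6) -> (3 * e <= dn)%N.
  rewrite le_min => /andP[ed _]; apply: le_dn; rewrite natrM mulrC.
  by rewrite -ler_pdivlMr.
have [|||||||N [M [[n1 n2 n3 n4] [n5 n6 n7 n8 [n9 n10]]]]] := @reservation V D Ap Am dn (4 * m)%N.
- by rewrite muln_gt0 m0.
- apply: le_dn; apply: le_trans td; apply: le_trans tx.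
  by rewrite mulnA.
- by move=> v /h1[h11 h12]; split; [apply: dn_le | apply: le_dn].
- by move=> v /h2[h21 h22]; split; [apply: dn_le | apply: le_dn].
- by move=> v vA; have [|/le_dn3 ? _] := h3 v; rewrite ?in_setU ?vA.
- by move=> v vA; have [|_ /le_dn3 ?] := h3 v; rewrite ?in_setU ?vA ?orbT.
- by move=> v /h4[h41 h42]; split; apply: dn_le.
apply: (@absorption V D Ap Am N M h m 32 (8 * (4 * m))%N a j k 61 disj
  n1 n2 n3 n4 n5 _ _ n8 n9 n10 _ _ _ h0 m0 Vr Va Vj Vk sh).
- by move=> v /n6; apply: leq_trans; move: hm; clear; lia.
- by move=> v /n7; apply: leq_trans; move: hm; clear; lia.
- by rewrite mulnA.
- by move=> v /ApE; move: m0; clear; lia.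
- by move=> v /AmE; move: m0; clear; lia.
Qed.
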